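(* Let Assumptions 1 and 2 hold and let $K<\mu<1$. There exists a constant $c_\mu>0$ such that, for every $\delta\in(0,K)$, if $x^{(0)}\in U\cap\Sigma$ satisfies $0<\|r^{(0)}\|_2\le c_\mu\delta^2$ and one runs version P of the adaptive-depth Anderson–Pulay acceleration with parameter $\delta$ (or version A when $\Sigma=\mathbb{R}^n$), then the sequences $(x^{(k)})$, $(r^{(k)})$ are well defined and, as long as $r^{(k)}\neq0$: $$m_k\le\min(k,p),\qquad \|c^{(k)}\|_\infty\le C_{m_k}\Big(1+\Big(\frac{\mu}{1-\mu}\Big)^{m_k}\Big),\qquad \|r^{(k+1)}\|_2\le\mu\|r^{(k)}\|_2,$$ where $C_{m_k}>0$ depends only on $m_k$; in particular the method is locally q-linearly convergent. Moreover, if $k-m_k\ge1$, then $\|r^{(k)}\|_2\le\delta\|r^{(k-m_k-1)}\|_2$.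
   Context: All norms $\|\cdot\|_2$ are Euclidean. Let $n,p\ge1$ be integers, $\Sigma$ a smooth submanifold of $\mathbb{R}^n$, $V\subset\mathbb{R}^n$ open, $f\in\mathscr{C}^2(V,\mathbb{R}^p)$, $g\in\mathscr{C}^2(V,\Sigma)$, and $x_*\in V\cap\Sigma$ with $g(x_* )=x_*$, $f(x_* )=0$. Assumption 1: there is $K\in(0,1)$ with $\|f(g(x))\|_2\le K\|f(x)\|_2$ for all $x\in V\cap g^{-1}(V)\cap\Sigma$. Assumption 2: there is $\sigma>0$ with $\sigma\|x-x_*\|_2\le\|f(x)\|_2$ for all $x\in V\cap\Sigma$. $U\subset V\cap g^{-1}(V)$ is a fixed open neighbourhood of $x_*$ such that: (i) for all $x,y\in U$, $\|f(x)-f(y)\|_2\le 2\|\mathrm{D}f(x_* )\|_2\|x-y\|_2$ and $\|f(g(x))-f(g(y))\|_2\le 2\|\mathrm{D}f(x_* )\circ \mathrm{D}g(x_* )\|_2\|x-y\|_2$; (ii) there are $L,L'>0$ with $\|f(x)-\mathrm{D}f(x_* )(x-x_* )\|_2\le\frac L2\|x-x_*\|_2^2$ and $\|g(x)-x_*-\mathrm{D}g(x_* )(x-x_* )\|_2\le\frac{L'}2\|x-x_*\|_2^2$ on $U$; (iii) $U$ is a tubular neighbourhood of $\Sigma\cap U$ on which the nearest-point projection $P_\Sigma$ onto $\Sigma$ is well defined and smooth, and for some $M>0$, $\|P_\Sigma(x)-(x_*+P_{T_{x_*}\Sigma}(x-x_* ))\|_2\le\frac M2\|x-x_*\|_2^2$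 on $U$ ($P_{T_{x_*}\Sigma}$ the orthogonal projector onto the tangent space at $x_*$). Adaptive-depth Anderson–Pulay acceleration with parameter $\delta>0$: given $x^{(0)}$, set $r^{(0)}=f(x^{(0)})$, $m_0=0$. At step $k$: if $m_k=0$, set $c^{(k)}=(1)$ and $x^{(k+1)}=g(x^{(k)})$; otherwise let $c^{(k)}=(c^{(k)}_0,\dots,c^{(k)}_{m_k})$ minimise $\|\sum_{i=0}^{m_k}c_i r^{(k-m_k+i)}\|_2$ subject to $\sum_i c_i=1$, and set $x^{(k+1)}=g\big(\sum_{i=0}^{m_k}c^{(k)}_i x^{(k-m_k+i)}\big)$ (version P) or $x^{(k+1)}=\sum_{i=0}^{m_k}c^{(k)}_i g(x^{(k-m_k+i)})$ (version A, used only when $\Sigma=\mathbb{R}^n$). Then $r^{(k+1)}=f(x^{(k+1)})$ and $m_{k+1}$ is the largest integer $m\le m_k+1$ such that $\delta\|r^{(i)}\|_2<\|r^{(k+1)}\|_2$ for all $i$ with $k+1-m\le i\le k$. Convention: if $r^{(k_{\rm stop})}=0$ for some $k_{\rm stop}$, then $x^{(k)}=x^{(k_{\rm stop})}$, $r^{(k)}=0$, $m_k=0$ for all $k\ge k_{\rm stop}$. *)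

(* Defs.v *)
From Stdlib Require Import Reals.
From mathcomp Require Import all_boot.

Set Implicit Arguments.
Unset Strict Implicit.
Unset Printing Implicit Defensive.

Local Open Scope R_scope.

Definition vec (n : nat) := 'I_n -> R.
Definition mat (p n : nat) := 'I_p -> 'I_n -> R.

Definition vzero {n : nat} : vec n := fun _ => 0.
Definition vadd {n : nat} (u v : vec n) : vec n := fun i => u i + v i.
Definition vsub {n : nat} (u v : vec n) : vec n := fun i => u i - v i.
Definition vscale {n : nat} (a : R) (v : vec n) : vec n := fun i => a * v i.
Definition ebasis {n : nat} (j : 'I_n) : vec n :=
  fun i => if i == j then 1 else 0.

Definition dot {n : nat} (u v : vec n) : R := \big[Rplus/0]_(i < n) (u i * v i).
Definition norm2 {n : nat} (v : vec n) : R := sqrt (dot v v).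

Definition mapply {p n : nat} (A : mat p n) (v : vec n) : vec p :=
  fun i => \big[Rplus/0]_(j < n) (A i j * v j).
Definition mmul {p n q : nat} (A : mat p n) (B : mat n q) : mat p q :=
  fun i k => \big[Rplus/0]_(j < n) (A i j * B j k).

Definition is_opnorm {p n : nat} (A : mat p n) (N : R) : Prop :=
  is_lub (fun t => exists v : vec n, norm2 v <= 1 /\ t = norm2 (mapply A v)) N.

Definition is_open {n : nat} (W : vec n -> Prop) : Prop :=
  forall x, W x -> exists eps, 0 < eps /\
    forall y, norm2 (vsub y x) < eps -> W y.

Definition cont_on {n : nat} (W : vec n -> Prop) (F : vec n -> R) : Prop :=
  forall x, W x -> forall eps, 0 < eps -> exists d, 0 < d /\
    forall y, norm2 (vsub y x) < d -> Rabs (F y - F x) < eps.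

Definition partial_at {n : nat} (F : vec n -> R) (x : vec n) (j : 'I_n) (l : R) : Prop :=
  derivable_pt_lim (fun t => F (vadd x (vscale t (ebasis j)))) 0 l.

Fixpoint Ck {n : nat} (k : nat) (W : vec n -> Prop) (F : vec n -> R) : Prop :=
  cont_on W F /\
  match k with
  | O => True
  | S k' => exists G : 'I_n -> vec n -> R,
      (forall j x, W x -> partial_at F x j (G j x)) /\
      (forall j, Ck k' W (G j))
  end.

Definition CkV {n p : nat} (k : nat) (W : vec n -> Prop) (f : vec n -> vec p) : Prop :=
  forall i : 'I_p, Ck k W (fun x => f x i).

Definition Cinf {n p : nat} (W : vec n -> Prop) (f : vec n -> vec p) : Prop :=
  forall k, CkV k W f.

Definition is_jacobian {n p : nat} (f : vec n -> vec p) (x : vec n) (J : mat p n) : Prop :=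
  forall i j, partial_at (fun y => f y i) x j (J i j).

Definition is_smooth_submanifold {n : nat} (S : vec n -> Prop) : Prop :=
  exists d : nat, (d <= n)%nat /\
  forall a, S a -> exists (W : vec n -> Prop) (phi : vec n -> vec (n - d)),
    is_open W /\ W a /\ Cinf W phi /\
    (forall y, W y -> exists J, is_jacobian phi y J /\
        forall w, exists v, mapply J v = w) /\
    (forall y, W y -> (S y <-> phi y = vzero)).

Definition tangent_vec {n : nat} (S : vec n -> Prop) (a v : vec n) : Prop :=
  exists gam : R -> vec n, gam 0 = a /\
    (exists eps, 0 < eps /\ forall t, Rabs t < eps -> S (gam t)) /\
    (forall i, derivable_pt_lim (fun t => gam t i) 0 (v i)).

Definition is_orth_proj {n : nat} (T : vec n -> Prop) (w v : vec n) : Prop :=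
  T v /\ forall u, T u -> dot (vsub w v) u = 0.

Inductive ap_version := VersionP | VersionA.

Definition lincomb {q : nat} (m : nat) (c : nat -> R) (X : nat -> vec q) : vec q :=
  fun j => sum_f_R0 (fun i => c i * X i j) m.
Definition csum (m : nat) (c : nat -> R) : R := sum_f_R0 c m.

Definition is_ap_coef {p : nat} (m : nat) (Rs : nat -> vec p) (c : nat -> R) : Prop :=
  csum m c = 1 /\
  forall c', csum m c' = 1 -> norm2 (lincomb m c Rs) <= norm2 (lincomb m c' Rs).

Definition depth_ok {p : nat} (delta : R) (r : nat -> vec p) (k mm : nat) : Prop :=
  forall i, (k.+1 - mm <= i)%nat -> (i <= k)%nat -> delta * norm2 (r i) < norm2 (r k.+1).

(* (x, r, m, c) is a run of the method from x0 with parameter delta.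
   c k i (0 <= i <= m k) is the coefficient vector c^(k).  After r^(k) = 0 the
   iterates are frozen (stopping convention); the depth rule then yields m = 0. *)
Definition ap_run {n p : nat} (f : vec n -> vec p) (g : vec n -> vec n)
  (delta : R) (ver : ap_version) (x0 : vec n)
  (x : nat -> vec n) (r : nat -> vec p) (m : nat -> nat) (c : nat -> nat -> R) : Prop :=
  x 0%nat = x0 /\ m 0%nat = 0%nat /\
  (forall k, r k = f (x k)) /\
  (forall k, r k = vzero -> x k.+1 = x k) /\
  (forall k, r k <> vzero -> m k = 0%nat ->
      c k 0%nat = 1 /\ x k.+1 = g (x k)) /\
  (forall k, r k <> vzero -> m k <> 0%nat ->
      is_ap_coef (m k) (fun i => r (k - m k + i)%nat) (c k) /\
      x k.+1 = match ver with
               | VersionP => g (lincomb (m k) (c k) (fun i => x (k - m k + i)%nat))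
               | VersionA => lincomb (m k) (c k) (fun i => g (x (k - m k + i)%nat))
               end) /\
  (forall k, (m k.+1 <= (m k).+1)%nat /\ depth_ok delta r k (m k.+1) /\
      forall mm, (m k.+1 < mm)%nat -> (mm <= (m k).+1)%nat -> ~ depth_ok delta r k mm).

(* Main.v *)
(* The iterates stay on Sigma, so f controls the distance to xs: |x - xs| <= |f x| / sigma.
   Comparing the affine combination of the iterates with its projection PS on Sigma (second-order
   Taylor expansion of PS at xs), where Assumption 1 applies, gives
   |r_(k+1)| <= K |rho_k| + C e^2, with rho_k the least-squares residual and e a bound on the
   residuals of the window.  Since e <= |r_0| <= c delta^2 and delta e <= |r_k|, the error is at
   most (mu - K) |r_k|; and if k stays in the window of step k+1, then delta |r_k| < |r_(k+1)|,
   so the error is also at most (mu - K) |r_(k+1)|, whence |r_(k+1)| <= mu |rho_k|.  As rho_k is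
   orthogonal to the differences of the residuals of its window, the latter bound makes the
   residuals of every window affinely independent (so m_k <= p), with a conditioning that
   depends only on mu and m_k. *)
Require Import Defs.
From Stdlib Require Import Reals.
From mathcomp Require Import all_boot.
From Stdlib Require Import Lra FunctionalExtensionality Classical ClassicalChoice.
From mathcomp Require Import zify ssralg matrix mxalgebra Rstruct.
Local Open Scope R_scope.

(** * Euclidean vectors *)

Lemma bigR_distrr (I : Type) (s : seq I) (P : pred I) (F : I -> R) (a : R) :
  a * \big[Rplus/0]_(i <- s | P i) F i = \big[Rplus/0]_(i <- s | P i) (a * F i).
Proof. exact: big_distrr. Qed.

Lemma bigR_le (I : Type) (s : seq I) (P : pred I) (F G : I -> R) :
  (forall i, P i -> F i <= G i) ->
  \big[Rplus/0]_(i <- s | P i) F i <= \big[Rplus/0]_(i <- s | P i) G i.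
Proof. by move=> h; apply: (big_ind2 Rle) => //; [exact: Rle_refl | move=> *; lra]. Qed.

Lemma bigR_ge0 (I : Type) (s : seq I) (P : pred I) (F : I -> R) :
  (forall i, P i -> 0 <= F i) -> 0 <= \big[Rplus/0]_(i <- s | P i) F i.
Proof. by move=> h; apply: (big_ind (Rle 0)) => //; [exact: Rle_refl | move=> *; lra]. Qed.

Lemma bigR_le_term n (F : 'I_n -> R) (i : 'I_n) :
  (forall j, 0 <= F j) -> F i <= \big[Rplus/0]_(j < n) F j.
Proof.
move=> h; rewrite (bigD1 i) //= -{1}(Rplus_0_r (F i)).
by apply: Rplus_le_compat_l; apply: bigR_ge0.
Qed.

Lemma dotC {n} (u v : vec n) : dot u v = dot v u.
Proof. by apply: eq_bigr => i _; ring. Qed.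

Lemma dotDl {n} (u v w : vec n) : dot (vadd u v) w = dot u w + dot v w.
Proof. by rewrite /dot -big_split; apply: eq_bigr => i _; rewrite /vadd /=; ring. Qed.

Lemma dotZl {n} (a : R) (u w : vec n) : dot (vscale a u) w = a * dot u w.
Proof. by rewrite /dot bigR_distrr; apply: eq_bigr => i _; rewrite /vscale; ring. Qed.

Lemma vsubE {n} (u v : vec n) : vsub u v = vadd u (vscale (-1) v).
Proof. by apply: functional_extensionality => i; rewrite /vsub /vadd /vscale; ring. Qed.

Lemma dotBl {n} (u v w : vec n) : dot (vsub u v) w = dot u w - dot v w.
Proof. by rewrite vsubE dotDl dotZl; ring. Qed.

Lemma dotDr {n} (u v w : vec n) : dot w (vadd u v) = dot w u + dot w v.
Proof. by rewrite dotC dotDl !(dotC w). Qed.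

Lemma dotZr {n} (a : R) (u w : vec n) : dot w (vscale a u) = a * dot w u.
Proof. by rewrite dotC dotZl dotC. Qed.

Lemma dotBr {n} (u v w : vec n) : dot w (vsub u v) = dot w u - dot w v.
Proof. by rewrite dotC dotBl !(dotC w). Qed.

Lemma sumR_ext (F G : nat -> R) m :
  (forall i, (i <= m)%nat -> F i = G i) -> sum_f_R0 F m = sum_f_R0 G m.
Proof. by move=> h; apply: PartSum.sum_eq => i /leP; exact: h. Qed.

Lemma dot_lincomb {n} m (c : nat -> R) (X : nat -> vec n) (w : vec n) :
  dot (lincomb m c X) w = sum_f_R0 (fun i => c i * dot (X i) w) m.
Proof.
elim: m => [|m IH] /=; first by rewrite -dotZl.
by rewrite -IH -dotZl -dotDl.
Qed.

Lemma dot_ge0 {n} (v : vec n) : 0 <= dot v v.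
Proof. by apply: bigR_ge0 => i _; exact: Rle_0_sqr. Qed.

Lemma dot_eq0 {n} (v : vec n) : dot v v = 0 -> v = vzero.
Proof.
move=> h; apply: functional_extensionality => i.
have := bigR_le_term _ (fun j => v j * v j) i (fun j => Rle_0_sqr (v j)).
rewrite -/(dot v v) h => hi.
rewrite /vzero; have := Rle_0_sqr (v i); rewrite /Rsqr => h2.
have /Rmult_integral : v i * v i = 0 by lra.
by case.
Qed.

Lemma norm2_ge0 {n} (v : vec n) : 0 <= norm2 v.
Proof. exact: sqrt_pos. Qed.

Lemma norm2_sq {n} (v : vec n) : norm2 v * norm2 v = dot v v.
Proof. exact/sqrt_sqrt/dot_ge0. Qed.

Lemma norm2_eq0 {n} (v : vec n) : norm2 v = 0 -> v = vzero.
Proof. by move=> h; apply: dot_eq0; rewrite -norm2_sq h; ring. Qed.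

Lemma norm2_vzero n : norm2 (@vzero n) = 0.
Proof.
rewrite /norm2 /dot big1 ?sqrt_0 // => i _.
by rewrite /vzero; exact: Rmult_0_l.
Qed.

Lemma norm2_gt0 {n} (v : vec n) : v <> vzero -> 0 < norm2 v.
Proof.
by move=> h; case: (norm2_ge0 v) => // /esym /norm2_eq0 /h.
Qed.

Lemma norm2Z {n} (a : R) (v : vec n) : norm2 (vscale a v) = Rabs a * norm2 v.
Proof.
rewrite /norm2 dotZl dotZr -Rmult_assoc sqrt_mult_alt; last exact: Rle_0_sqr.
by rewrite sqrt_Rsqr_abs.
Qed.

Lemma le_of_sq a b : 0 <= b -> a * a <= b * b -> a <= b.
Proof. by move=> hb h; apply: Rnot_lt_le => hab; nra. Qed.

(** The squared norm of [(v.v) u - (u.v) v] equals [v.v] times the Gram determinant of [u] and [v];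
    the degenerate case [v.v = 0] is treated apart. *)
Lemma cauchy_schwarz {n} (u v : vec n) : Rabs (dot u v) <= norm2 u * norm2 v.
Proof.
have [hu hv] := (norm2_ge0 u, norm2_ge0 v).
apply: le_of_sq; first exact: Rmult_le_pos.
have -> : Rabs (dot u v) * Rabs (dot u v) = dot u v * dot u v.
  by rewrite -Rabs_mult Rabs_pos_eq //; exact: Rle_0_sqr.
have -> : norm2 u * norm2 v * (norm2 u * norm2 v) = dot u u * dot v v.
  by rewrite -!norm2_sq; ring.
have := dot_ge0 (vsub (vscale (dot v v) u) (vscale (dot u v) v)).
rewrite !(dotBl, dotBr, dotZl, dotZr) (dotC v u).
have [hv0|hv0] := Req_dec (dot v v) 0.
  rewrite hv0 (dot_eq0 v hv0) => _.
  have -> : dot u vzero = 0.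
    by rewrite /dot big1 // => i _; exact: Rmult_0_r.
  lra.
have hv1 := dot_ge0 v => h.
have : 0 <= dot v v * (dot u u * dot v v - dot u v * dot u v) by nra.
by move=> h3; nra.
Qed.

Lemma norm2D {n} (u v : vec n) : norm2 (vadd u v) <= norm2 u + norm2 v.
Proof.
have [hu hv] := (norm2_ge0 u, norm2_ge0 v).
apply: le_of_sq; first lra.
rewrite norm2_sq !(dotDl, dotDr) (dotC v u) -!norm2_sq.
have := cauchy_schwarz u v; have := Rle_abs (dot u v); lra.
Qed.

Lemma norm2_subC {n} (u v : vec n) : norm2 (vsub u v) = norm2 (vsub v u).
Proof.
have -> : vsub u v = vscale (-1) (vsub v u).
  by apply: functional_extensionality => i; rewrite /vsub /vscale; ring.
by rewrite norm2Z Rabs_Ropp Rabs_R1 Rmult_1_l.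
Qed.

Lemma norm2_le_add {n} (u v : vec n) : norm2 u <= norm2 v + norm2 (vsub u v).
Proof.
have {1}-> : u = vadd v (vsub u v).
  by apply: functional_extensionality => i; rewrite /vsub /vadd; ring.
exact: norm2D.
Qed.

Lemma norm2_coord {n} (v : vec n) (i : 'I_n) : Rabs (v i) <= norm2 v.
Proof.
apply: le_of_sq; first exact: norm2_ge0.
rewrite norm2_sq -Rabs_mult Rabs_pos_eq; last exact: Rle_0_sqr.
exact: (bigR_le_term _ (fun j => v j * v j) i (fun j => Rle_0_sqr (v j))).
Qed.

Lemma norm2_mono {n} (u v : vec n) :
  (forall i, Rabs (u i) <= Rabs (v i)) -> norm2 u <= norm2 v.
Proof.
move=> h; apply: sqrt_le_1_alt; apply: bigR_le => i _.
exact: Rsqr_le_abs_1.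
Qed.

Lemma bigR_const n (b : R) : \big[Rplus/0]_(i < n) b = INR n * b.
Proof.
elim: n => [|n IH]; first by rewrite big_ord0 Rmult_0_l.
by rewrite big_ord_recr IH S_INR /=; ring.
Qed.

(** The factor [n] in place of its square root is crude but harmless: it only enters constants. *)
Lemma norm2_le_coord {n} (v : vec n) (b : R) :
  0 <= b -> (forall i, Rabs (v i) <= b) -> norm2 v <= INR n * b.
Proof.
move=> hb h; have hn : 0 <= INR n by exact: pos_INR.
apply: le_of_sq; first exact: Rmult_le_pos.
apply: (Rle_trans _ (INR n * (b * b))).
  rewrite norm2_sq -bigR_const; apply: bigR_le => i _.
  have := h i; have := Rle_abs (v i); have := Rle_abs (- v i).
  by rewrite Rabs_Ropp; nra.
case: (n) => [|k]; first by rewrite /=; lra.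
have : 1 <= INR k.+1 by rewrite S_INR; have := pos_INR k; lra.
by move=> h1; nra.
Qed.

(** * Linear and affine combinations of vectors *)

Lemma mapply_lincomb {p n} (A : mat p n) m c (X : nat -> vec n) :
  mapply A (lincomb m c X) = lincomb m c (fun i => mapply A (X i)).
Proof.
apply: functional_extensionality => i.
have aux (w : vec n) : mapply A w i = dot w (A i).
  by rewrite /mapply /dot; apply: eq_bigr => j _; ring.
rewrite aux dot_lincomb /lincomb.
by apply: sumR_ext => k _; rewrite aux.
Qed.

Lemma vsub_lincomb {n} m c (X Y : nat -> vec n) :
  vsub (lincomb m c X) (lincomb m c Y) = lincomb m c (fun i => vsub (X i) (Y i)).
Proof.
apply: functional_extensionality => j; rewrite /lincomb /vsub -PartSum.minus_sum.
by apply: sumR_ext => i _; ring.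
Qed.

Lemma lincomb_const {n} m c (v : vec n) : csum m c = 1 -> lincomb m c (fun=> v) = v.
Proof.
move=> h; apply: functional_extensionality => j.
by rewrite /lincomb -PartSum.scal_sum -/(csum m c) h; ring.
Qed.

Lemma norm2_lincomb {n} m c (X : nat -> vec n) (e : R) :
  (forall i, (i <= m)%nat -> norm2 (X i) <= e) ->
  norm2 (lincomb m c X) <= sum_f_R0 (fun i => Rabs (c i)) m * e.
Proof.
elim: m => [|m IH] h /=.
  rewrite (_ : lincomb _ _ _ = vscale (c 0%nat) (X 0%nat)) // norm2Z.
  by apply: Rmult_le_compat_l; [exact: Rabs_pos | exact: h].
rewrite (_ : lincomb _ _ _ = vadd (lincomb m c X) (vscale (c m.+1) (X m.+1))) //.
have := norm2D (lincomb m c X) (vscale (c m.+1) (X m.+1)).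
have h1 : norm2 (lincomb m c X) <= sum_f_R0 (fun i => Rabs (c i)) m * e.
  by apply: IH => i hi; apply: h; lia.
rewrite norm2Z.
have := Rmult_le_compat_l _ _ _ (Rabs_pos (c m.+1)) (h m.+1 (leqnn _)); lra.
Qed.

(** Coefficients of sum one reproduce the constant [v], so the deviation is the combination of the
    deviations. *)
Lemma lincomb_dev {n} m c (X Y : nat -> vec n) (v : vec n) (e : R) :
  csum m c = 1 ->
  (forall i, (i <= m)%nat -> norm2 (vsub (X i) v) <= e) ->
  norm2 (vsub (lincomb m c X) v) <= sum_f_R0 (fun i => Rabs (c i)) m * e.
Proof.
move=> hc h; rewrite -{1}(lincomb_const m c v hc) vsub_lincomb.
exact: norm2_lincomb.
Qed.

(** * Affine least squares *)

Lemma csum_delta m j : (j <= m)%nat -> csum m (fun i => if i == j then 1 else 0) = 1.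
Proof.
rewrite /csum; elim: m => [|m IH]; first by rewrite leqn0 => /eqP ->.
rewrite leq_eqVlt => /orP [/eqP ->|hj] /=.
  rewrite eqxx (sumR_ext _ (fun=> 0)) ?sum_cte; first by rewrite Rmult_0_l Rplus_0_l.
  by move=> i hi; case: eqP => // h; lia.
rewrite IH //; case: eqP => h; [lia | ring].
Qed.

Lemma csum_lin m (a b : R) c d :
  csum m (fun i => a * c i + b * d i) = a * csum m c + b * csum m d.
Proof. by rewrite /csum; elim: m => [|m /= ->]; rewrite /=; ring. Qed.

Lemma lincomb_lin {n} m (a b : R) c d (X : nat -> vec n) :
  lincomb m (fun i => a * c i + b * d i) X
  = vadd (vscale a (lincomb m c X)) (vscale b (lincomb m d X)).
Proof.
apply: functional_extensionality => j; rewrite /lincomb /vadd /vscale.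
by elim: m => [|m /= ->]; rewrite /=; ring.
Qed.

Lemma lincomb_delta {n} m j (X : nat -> vec n) : (j <= m)%nat ->
  lincomb m (fun i => if i == j then 1 else 0) X = X j.
Proof.
move=> hj; apply: functional_extensionality => k.
have := PartSum.scal_sum (fun i => if i == j then 1 else 0) m (X j k).
rewrite -/(csum m _) csum_delta // Rmult_1_r => ->; rewrite /lincomb.
by apply: sumR_ext => i _; case: eqP => [-> |_]; ring.
Qed.

Lemma ap_coef_norm_le {p} m (Rs : nat -> vec p) c i :
  is_ap_coef m Rs c -> (i <= m)%nat -> norm2 (lincomb m c Rs) <= norm2 (Rs i).
Proof.
by move=> [_ h] hi; rewrite -(lincomb_delta m i Rs hi); apply/h/csum_delta.
Qed.

Lemma quad_min (a b : R) : (forall t, 0 <= t * (2 * b) + t * t * a) -> b = 0.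
Proof.
move=> h; case: (Rle_lt_dec a 0) => ha.
  by have := h 1; have := h (-1); lra.
have := h (- b / a).
have -> : - b / a * (2 * b) + - b / a * (- b / a) * a = - (b * b / a) by field; lra.
move=> h1; have h2 : b * b / a * a = b * b by field; lra.
have [] := Rtotal_order b 0 => [h3|[//|h3]]; nra.
Qed.

(** First-order optimality: moving the coefficients towards the i-th unit vector keeps their sum
    equal to one, and the change of the squared norm is a nonnegative quadratic in [t], so its
    linear term vanishes. Hence the minimal residual is orthogonal to all differences of the
    [Rs i]. *)
Lemma ap_coef_orth {p} m (Rs : nat -> vec p) c i :
  is_ap_coef m Rs c -> (i <= m)%nat ->
  dot (Rs i) (lincomb m c Rs) = dot (lincomb m c Rs) (lincomb m c Rs).
Proof.
move=> [hc h] hi; set rho := lincomb m c Rs.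
have H (t : R) : 0 <= t * (2 * dot (vsub (Rs i) rho) rho)
    + t * t * dot (vsub (Rs i) rho) (vsub (Rs i) rho).
  have := h (fun k => (1 - t) * c k + t * (if k == i then 1 else 0)).
  rewrite csum_lin csum_delta // hc lincomb_lin lincomb_delta // -/rho => hh.
  have {}hh : norm2 rho <= norm2 (vadd (vscale (1 - t) rho) (vscale t (Rs i))).
    by apply: hh; ring.
  have := Rmult_le_compat _ _ _ _ (norm2_ge0 rho) (norm2_ge0 rho) hh hh.
  rewrite !norm2_sq !(dotDl, dotDr, dotBl, dotBr, dotZl, dotZr).
  rewrite (dotC rho (Rs i)); lra.
by have := quad_min _ _ H; rewrite dotBl; lra.
Qed.

(** Gram-Schmidt by induction: [w'] and [v'] are the residuals of [w] and of the new vector with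
    respect to the old ones, and the component of [w'] along [v'] is removed. Linear dependence of
    the [v i] is allowed. *)
Lemma lin_residual_exists {p} m (v : nat -> vec p) (w : vec p) :
  exists t, forall i, (i <= m)%nat -> dot (v i) (vsub w (lincomb m t v)) = 0.
Proof.
(* If [u] is zero, both terms vanish whatever the quotient by zero is; this covers dependent
   vectors. *)
have div0 (z u : vec p) : dot u z - dot u z / dot u u * dot u u = 0.
  have [h|h] := Req_dec (dot u u) 0; last by field.
  rewrite (dot_eq0 _ h); have -> : dot vzero z = 0.
    by rewrite /dot big1 // => i _; exact: Rmult_0_l.
  by rewrite /Rdiv; ring.
elim: m w => [|m IH] w.
  exists (fun=> dot (v 0%nat) w / dot (v 0%nat) (v 0%nat)) => i.
  rewrite leqn0 => /eqP ->.
  rewrite (_ : lincomb _ _ _ = vscale (dot (v 0%nat) w / dot (v 0%nat) (v 0%nat)) (v 0%nat)) //.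
  by rewrite dotBr dotZr.
have [t ht] := IH w; have [s hs] := IH (v m.+1).
set w' := vsub w _ in ht; set v' := vsub (v m.+1) _ in hs.
pose a := dot v' w' / dot v' v'.
pose t' i := if i == m.+1 then a else 1 * t i + (- a) * s i.
have ez : vsub w (lincomb m.+1 t' v) = vsub w' (vscale a v').
  have el : lincomb m t' v = lincomb m (fun i => 1 * t i + (- a) * s i) v.
    apply: functional_extensionality => j; apply: sumR_ext => i hi.
    by rewrite /t'; case: eqP => //; lia.
  have -> : lincomb m.+1 t' v = vadd (lincomb m t' v) (vscale (t' m.+1) (v m.+1)) by [].
  rewrite el lincomb_lin /t' eqxx.
  apply: functional_extensionality => j; rewrite /w' /v' /vsub /vadd /vscale; ring.
exists t' => i; rewrite ez => hi.
have h0 k : (k <= m)%nat -> dot (v k) (vsub w' (vscale a v')) = 0.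
  by move=> hk; rewrite dotBr dotZr ht // hs //; ring.
move: hi; rewrite leq_eqVlt => /orP [/eqP ->|]; last exact: h0.
have -> : v m.+1 = vadd v' (lincomb m s v).
  by apply: functional_extensionality => j; rewrite /v' /vsub /vadd; ring.
rewrite dotDl dot_lincomb (sumR_ext _ (fun=> 0)).
  by rewrite sum_cte dotBr dotZr /a -[RHS](div0 w' v'); ring.
by move=> k hk; rewrite h0 //; ring.
Qed.

(** The normal equations suffice: if all [Rs i] have the same product with [rho], so has every
    affine combination, and expanding the squared distance to [rho] shows minimality. They are
    solved by eliminating the coefficient of index 0, which leaves an unconstrained problem for the
    differences with [Rs 0]. *)
Lemma ap_coef_exists {p} m (Rs : nat -> vec p) : exists c, is_ap_coef m Rs c.
Proof.
suff [c [hc h]] : exists c, csum m c = 1 /\ forall i, (i <= m)%nat ->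
    dot (Rs i) (lincomb m c Rs) = dot (Rs 0%nat) (lincomb m c Rs).
  exists c; split => // c' hc'; set rho := lincomb m c Rs.
  have aux d : csum m d = 1 -> dot (lincomb m d Rs) rho = dot (Rs 0%nat) rho.
    move=> hd; rewrite dot_lincomb.
    rewrite (sumR_ext _ (fun i => d i * dot (Rs 0%nat) rho)).
      by rewrite -PartSum.scal_sum -/(csum m d) hd; ring.
    by move=> i hi; rewrite h.
  have h1 := aux c hc; have h2 := aux c' hc'.
  apply: le_of_sq; first exact: norm2_ge0.
  have := dot_ge0 (vsub (lincomb m c' Rs) rho).
  rewrite !norm2_sq -/rho !(dotBl, dotBr) (dotC rho (lincomb _ _ _)) h2.
  by rewrite -h1 -/rho; lra.
case: m => [|m].
  exists (fun=> 1); split => // i; rewrite leqn0 => /eqP -> //.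
have [t ht] := lin_residual_exists m (fun i => vsub (Rs i.+1) (Rs 0%nat)) (Rs 0%nat).
pose c i := if i is k.+1 then - t k else 1 + csum m t.
have hsplit (F : nat -> R) : sum_f_R0 F m.+1 = F 0%nat + sum_f_R0 (fun i => F i.+1) m.
  by elim: m {t ht c} => [//|m IH]; rewrite tech5 IH /=; ring.
exists c; split.
  rewrite /csum hsplit /= (sumR_ext (fun i => - t i) (fun i => t i * (-1))).
    by rewrite -PartSum.scal_sum /csum; ring.
  by move=> i _; ring.
have -> : lincomb m.+1 c Rs
    = vsub (Rs 0%nat) (lincomb m t (fun i => vsub (Rs i.+1) (Rs 0%nat))).
  apply: functional_extensionality => j; rewrite /lincomb /vsub hsplit /=.
  rewrite /csum; elim: (m) => [|k IH] /=; first by ring.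
  by lra.
case=> [//|i] hi; have := ht i hi; rewrite dotBl; lra.
Qed.

(** * Conditioning of the coefficients *)

(** Elimination from the last index. Subtracting the last row from the sum of the coefficients
    leaves [c m (1 - a m m)], so the last coefficient is at most [(q - 1) B]. Dropping it from the
    other rows degrades their bound from [B] to [q B], and the induction closes because
    [(2 q^m - 1) q + (q - 1) = 2 q^(m+1) - 1]. *)
Lemma coef_sum_bound (mu : R) m (c : nat -> R) (a : nat -> nat -> R) (B : R) :
  mu < 1 -> Rabs (csum m c) <= B ->
  (forall j, (0 < j <= m)%nat ->
     (forall i, (i < j)%nat -> a i j = 1) /\ a j j <= mu /\
     (forall i, (j < i <= m)%nat -> Rabs (a i j) <= 1) /\
     Rabs (sum_f_R0 (fun i => c i * a i j) m) <= B) ->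
  sum_f_R0 (fun i => Rabs (c i)) m <= (2 * (1 + 2 / (1 - mu)) ^ m - 1) * B.
Proof.
move=> hmu; set q := 1 + 2 / (1 - mu).
elim: m B => [|m IH] B hc h; first by rewrite /= in hc *; lra.
have [h1 [h2 [_ h4]]] := h m.+1 (leqnn _).
have hcm : Rabs (c m.+1) <= (q - 1) * B.
  have e : c m.+1 * (1 - a m.+1 m.+1)
      = csum m.+1 c - sum_f_R0 (fun i => c i * a i m.+1) m.+1.
    rewrite /csum /= (sumR_ext (fun i => c i * a i m.+1) c m); first by ring.
    by move=> i hi; rewrite h1 //; ring.
  have h5 : Rabs (c m.+1) * (1 - mu) <= 2 * B.
    apply: (Rle_trans _ (Rabs (c m.+1) * Rabs (1 - a m.+1 m.+1))).
      apply: Rmult_le_compat_l; first exact: Rabs_pos.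
      by have := Rle_abs (1 - a m.+1 m.+1); lra.
    rewrite -Rabs_mult e; apply: (Rle_trans _ _ _ (Rabs_triang _ _)).
    by rewrite Rabs_Ropp; lra.
  have -> : (q - 1) * B = 2 * B / (1 - mu) by rewrite /q; field; lra.
  apply: (Rmult_le_reg_r (1 - mu)); first lra.
  by rewrite (_ : 2 * B / (1 - mu) * (1 - mu) = 2 * B) //; field; lra.
have trunc (d : nat -> R) : Rabs (d m.+1) <= (q - 1) * B ->
    Rabs (sum_f_R0 d m.+1) <= B -> Rabs (sum_f_R0 d m) <= q * B.
  move=> hd hs; have -> : sum_f_R0 d m = sum_f_R0 d m.+1 - d m.+1.
    by rewrite /=; ring.
  by have := Rabs_triang (sum_f_R0 d m.+1) (- d m.+1); rewrite Rabs_Ropp /Rminus; lra.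
have {}IH : sum_f_R0 (fun i => Rabs (c i)) m <= (2 * q ^ m - 1) * (q * B).
  apply: IH; first exact: trunc.
  move=> j hj; have [|g1 [g2 [g3 g4]]] := h j; first lia.
  split=> //; split=> //; split; first by move=> i hi; apply: g3; lia.
  apply: trunc g4; rewrite Rabs_mult.
  have := Rmult_le_compat_l _ _ _ (Rabs_pos (c m.+1)) (g3 m.+1 ltac:(lia)); lra.
rewrite /=; lra.
Qed.

(** With [b = mu / (1 - mu)] the base [3 + 2 b] is the ratio [1 + 2 / (1 - mu)] of the elimination;
    it is at most 5 if [b <= 1] and at most [5 b] otherwise. *)
Lemma condition_pow_le (b : R) m : 0 < b -> (3 + 2 * b) ^ m <= 5 ^ m * (1 + b ^ m).
Proof.
move=> hb; have h5 : 0 < 5 ^ m by apply: pow_lt; lra.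
have hbm : 0 < b ^ m by apply: pow_lt.
case: (Rle_lt_dec b 1) => hb1.
  have : (3 + 2 * b) ^ m <= 5 ^ m by apply: pow_incr; lra.
  by nra.
have : (3 + 2 * b) ^ m <= (5 * b) ^ m by apply: pow_incr; lra.
by rewrite Rpow_mult_distr; nra.
Qed.

(** The matrix of the products [d i . w j] is lower triangular with nonzero diagonal, hence of rank
    [m], and it factors through dimension [p]. *)
Lemma staircase_le_dim p m (d w : 'I_m -> vec p) :
  (forall i j : 'I_m, (i < j)%nat -> dot (d i) (w j) = 0) ->
  (forall i, dot (d i) (w i) <> 0) -> (m <= p)%nat.
Proof.
move=> h0 h1.
pose A : 'M[R]_(m, p) := (\matrix_(i, j) d i j)%R.
pose B : 'M[R]_(p, m) := (\matrix_(i, j) w j i)%R.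
have eAB i j : (A *m B)%R i j = dot (d i) (w j).
  by rewrite mxE; apply: eq_bigr => k _; rewrite !mxE.
have trig : is_trig_mx (A *m B)%R.
  by apply/is_trig_mxP => i j hij; rewrite eAB h0.
have : ((A *m B)%R \in unitmx).
  rewrite unitmxE GRing.unitfE det_trig //; apply/GRing.prodf_neq0 => i _.
  by rewrite eAB; apply/eqP/h1.
move/mxrank_unit => e; rewrite -{1}e.
exact: leq_trans (mxrankM_maxl _ _) (rank_leq_col _).
Qed.

(** * Second-order Taylor expansion *)

Lemma dot_ebasis {n} (u : vec n) (k : 'I_n) : dot u (ebasis k) = u k.
Proof.
rewrite /dot /ebasis (bigD1 k) //= eqxx big1 ?Rplus_0_r ?Rmult_1_r //.
by move=> i /negbTE ->; exact: Rmult_0_r.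
Qed.

(** The mean value theorem for [F] on a coordinate line, after subtraction of the linear function of
    slope [l]. *)
Lemma mvt_along_coord {n} (F G : vec n -> R) (z : vec n) (k : 'I_n) (h l e : R) :
  (forall t, Rabs t <= Rabs h ->
     partial_at F (vadd z (vscale t (ebasis k))) k (G (vadd z (vscale t (ebasis k)))) /\
     Rabs (G (vadd z (vscale t (ebasis k))) - l) <= e) ->
  Rabs (F (vadd z (vscale h (ebasis k))) - F z - l * h) <= e * Rabs h.
Proof.
move=> H.
pose phi t := F (vadd z (vscale t (ebasis k))) - l * t.
pose phi' t := G (vadd z (vscale t (ebasis k))) - l.
have hR c : Rmin 0 h <= c <= Rmax 0 h -> Rabs c <= Rabs h.
  by rewrite /Rmin /Rmax; case: Rle_dec => ? ?; split_Rabs; lra.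
have D c : Rmin 0 h <= c <= Rmax 0 h -> derivable_pt_lim phi c (phi' c).
  move=> /hR /H [hp _]; rewrite /phi /phi'.
  apply: (derivable_pt_lim_minus (fun t => F (vadd z (vscale t (ebasis k)))) (fun t => l * t)).
    move=> eps /hp [del hdel]; exists del => s hs0 hs.
    have := hdel s hs0 hs.
    have -> : vadd (vadd z (vscale c (ebasis k))) (vscale (0 + s) (ebasis k))
       = vadd z (vscale (c + s) (ebasis k)).
      by apply: functional_extensionality => i; rewrite /vadd /vscale; ring.
    have -> : vadd (vadd z (vscale c (ebasis k))) (vscale 0 (ebasis k))
       = vadd z (vscale c (ebasis k)) => //.
    by apply: functional_extensionality => i; rewrite /vadd /vscale; ring.
  rewrite -{2}(Rmult_1_r l); exact: derivable_pt_lim_scal (derivable_pt_lim_id c).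
have [c [hc1 hc2]] := MVT_abs phi phi' 0 h D.
have -> : F (vadd z (vscale h (ebasis k))) - F z - l * h = phi h - phi 0.
  rewrite /phi (_ : vadd z (vscale 0 _) = z); first by ring.
  by apply: functional_extensionality => i; rewrite /vadd /vscale; ring.
rewrite hc1 Rminus_0_r; apply: Rmult_le_compat_r; first exact: Rabs_pos.
by have [] := H c (hR _ hc2).
Qed.

(** Only partial derivatives are available, so the way from [a] to [x] is made one coordinate at a
    time: [z k] has the first [k] coordinates of [x] and the others of [a]. *)
Lemma mean_value_ineq {n} (F : vec n -> R) (G : 'I_n -> vec n -> R) (a x l : vec n) (e : R) :
  0 <= e ->
  (forall y, norm2 (vsub y a) <= norm2 (vsub x a) ->
     forall j, partial_at F y j (G j y) /\ Rabs (G j y - l j) <= e) ->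
  Rabs (F x - F a - dot l (vsub x a)) <= e * (INR n * norm2 (vsub x a)).
Proof.
move=> he H.
pose z k : vec n := fun i => if (i < k)%nat then x i else a i.
have z0 : z 0%nat = a by apply: functional_extensionality.
have zn : z n = x by apply: functional_extensionality => i; rewrite /z ltn_ord.
have zS k (hk : (k < n)%nat) : z k.+1
    = vadd (z k) (vscale (vsub x a (Ordinal hk)) (ebasis (Ordinal hk))).
  apply: functional_extensionality => i; rewrite /z /vadd /vscale /vsub /ebasis ltnS.
  have [->|hne] := eqVneq i (Ordinal hk); first by rewrite /= leqnn ltnn; ring.
  have -> : (i <= k)%nat = (i < k)%nat.
    by rewrite leq_eqVlt; case: eqP => // h; case/eqP: hne; apply: val_inj.
  by ring.
suff S k : (k <= n)%nat -> Rabs (F (z k) - F a - dot l (vsub (z k) a))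
    <= e * (INR k * norm2 (vsub x a)) by have := S n (leqnn _); rewrite zn.
elim: k => [|k IH] hk.
  rewrite z0 dotBr /= !Rminus_diag Rabs_R0; lra.
set h := vsub x a (Ordinal hk); set u := z k; set k' := Ordinal hk.
have M : Rabs (F (vadd u (vscale h (ebasis k'))) - F u - l k' * h) <= e * Rabs h.
  (* On this segment every coordinate is at least as close to that of [a] as the one of [x] is, so
     the path does not leave the ball of the hypothesis. *)
  apply: (mvt_along_coord F (G k')) => t ht; apply: H; apply: norm2_mono => i.
  rewrite /u /z /vsub /vadd /vscale /ebasis.
  have [->|hne] := eqVneq i k'.
    by rewrite ltnn (_ : _ - _ = t) //; ring.
  rewrite Rmult_0_r Rplus_0_r; case: ifP => _; first exact: Rle_refl.
  by rewrite Rminus_diag Rabs_R0; exact: Rabs_pos.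
have hh : Rabs h <= norm2 (vsub x a) by exact: norm2_coord.
have {}IH := IH (ltnW hk); rewrite -/u in IH.
rewrite (zS _ hk) -/h -/k' -/u S_INR.
have -> : F (vadd u (vscale h (ebasis k'))) - F a
    - dot l (vsub (vadd u (vscale h (ebasis k'))) a)
  = (F (vadd u (vscale h (ebasis k'))) - F u - l k' * h) + (F u - F a - dot l (vsub u a)).
  by rewrite !dotBr dotDr dotZr dot_ebasis; ring.
apply: (Rle_trans _ _ _ (Rabs_triang _ _)).
have := Rmult_le_compat_l _ _ _ he hh; lra.
Qed.

Lemma common_radius (T : finType) (P : T -> R -> Prop) :
  (forall i d d', P i d -> 0 < d' <= d -> P i d') ->
  (forall i, exists d, 0 < d /\ P i d) -> exists d, 0 < d /\ forall i, P i d.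
Proof.
move=> hmon hex.
suff [d [hd h]] : exists d, 0 < d /\ forall i, i \in enum T -> P i d.
  by exists d; split => // i; apply: h; rewrite mem_enum.
elim: (enum T) => [|j s [d [hd h]]]; first by exists 1; split => //; exact: Rlt_0_1.
have [d' [hd' h']] := hex j.
exists (Rmin d d'); split; first exact: Rmin_pos.
have hm : 0 < Rmin d d' by exact: Rmin_pos.
move=> i; rewrite inE => /orP [/eqP ->|hi].
  by apply: hmon h' _; split => //; exact: Rmin_r.
by apply: hmon (h i hi) _; split => //; exact: Rmin_l.
Qed.

(** One number [d] serves both as radius and as reciprocal of the bound. Statements of this form
    survive a decrease of [d], so [common_radius] can merge finitely many of them; the next two
    lemmas share the form. *)
Lemma cont_locally_bounded {n} (W : vec n -> Prop) (F : vec n -> R) a :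
  cont_on W F -> W a ->
  exists d, 0 < d /\ forall y, norm2 (vsub y a) < d -> d * Rabs (F y) <= 1.
Proof.
move=> hF /hF /(_ 1 Rlt_0_1) [d [hd h]].
have hA : 0 < Rabs (F a) + 1 by have := Rabs_pos (F a); lra.
exists (Rmin d (/ (Rabs (F a) + 1))); split.
  by apply: Rmin_pos => //; exact: Rinv_0_lt_compat.
move=> y hy; have hy1 : norm2 (vsub y a) < d := Rlt_le_trans _ _ _ hy (Rmin_l _ _).
have h1 : Rabs (F y) <= Rabs (F a) + 1 by have := h y hy1; split_Rabs; lra.
have h2 := Rmin_r d (/ (Rabs (F a) + 1)).
apply: (Rle_trans _ (/ (Rabs (F a) + 1) * (Rabs (F a) + 1))).
  apply: Rmult_le_compat => //; last exact: Rabs_pos.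
  by apply/Rlt_le/Rmin_pos => //; exact: Rinv_0_lt_compat.
by rewrite Rinv_l; lra.
Qed.

Lemma shrink_radius (d d' u v : R) : 0 <= u -> 0 < d' <= d -> d * u <= v -> d' * u <= v.
Proof. by move=> hu hd h; nra. Qed.

(** The partial derivatives are bounded by [1 / d] near [a], and the mean value inequality applies
    with zero linear part. *)
Lemma Ck1_lipschitz_at {n} (W : vec n -> Prop) (F : vec n -> R) a :
  is_open W -> W a -> Ck 1 W F ->
  exists d, 0 < d /\ forall x, norm2 (vsub x a) < d ->
    d * Rabs (F x - F a) <= norm2 (vsub x a).
Proof.
move=> hW ha [_ [G [hG hG0]]].
have [d0 [hd0 hB]] := hW a ha.
have [||d [hd h]] := @common_radius 'I_n
   (fun j d => forall y, norm2 (vsub y a) < d -> d * Rabs (G j y) <= 1).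
- move=> i d d' h hd' y hy; apply: shrink_radius (hd') (h y _); [exact: Rabs_pos | lra].
- by move=> j; apply: cont_locally_bounded ha; case: (hG0 j).
have hn := pos_INR n.
(* Division by [n + 1] absorbs the factor [n] of the mean value inequality and is safe for
   [n = 0]. *)
pose d1 := Rmin d0 (d / (INR n + 1)).
have hdn : 0 < d / (INR n + 1) by apply: Rdiv_lt_0_compat; lra.
have hd1 : 0 < d1 by exact: Rmin_pos.
have hdd : d / (INR n + 1) * (INR n + 1) = d by field; lra.
have hd1d : d1 <= d by have := Rmin_r d0 (d / (INR n + 1)); rewrite -/d1; nra.
exists d1; split => // x hx.
have hN := norm2_ge0 (vsub x a).
have hinv : 0 < / d by exact: Rinv_0_lt_compat.
have := mean_value_ineq F G a x vzero (/ d) (Rlt_le _ _ hinv).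
have -> : dot vzero (vsub x a) = 0.
  by rewrite /dot big1 // => i _; exact: Rmult_0_l.
rewrite Rminus_0_r => H.
have {}H : Rabs (F x - F a) <= / d * (INR n * norm2 (vsub x a)).
  apply: H => y hy j; split.
    by apply/hG/hB; have := Rmin_l d0 (d / (INR n + 1)); rewrite -/d1; lra.
  have := h j y ltac:(lra); rewrite /vzero Rminus_0_r => hj.
  by apply: (Rmult_le_reg_l d) => //; rewrite Rinv_r; lra.
apply: (Rle_trans _ (d1 * (/ d * (INR n * norm2 (vsub x a))))).
  by apply: Rmult_le_compat_l => //; lra.
have h1 : d1 * (INR n + 1) <= d.
  by rewrite -hdd; apply: Rmult_le_compat_r; [lra | exact: Rmin_r].
have h2 : d1 * INR n <= d by nra.
have -> : d1 * (/ d * (INR n * norm2 (vsub x a)))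
   = (d1 * INR n) * / d * norm2 (vsub x a) by ring.
rewrite -[X in _ <= X]Rmult_1_l; apply: Rmult_le_compat_r => //.
by rewrite -(Rinv_r d); [apply: Rmult_le_compat_r; lra | lra].
Qed.

(** The partial derivatives are Lipschitz at [a], so on the ball of radius [N] they differ from
    their values at [a] by at most [N / d]; the mean value inequality contributes the second factor
    [N]. *)
Lemma Ck2_taylor {n} (W : vec n -> Prop) (F : vec n -> R) a :
  is_open W -> W a -> Ck 2 W F ->
  exists l : vec n, exists d, 0 < d /\ forall x, norm2 (vsub x a) < d ->
    d * Rabs (F x - F a - dot l (vsub x a)) <= norm2 (vsub x a) ^ 2.
Proof.
move=> hW ha [_ [G [hG hG1]]].
have [d0 [hd0 hB]] := hW a ha.
have [||d [hd h]] := @common_radius 'I_n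
   (fun j d => forall y, norm2 (vsub y a) < d -> d * Rabs (G j y - G j a) <= norm2 (vsub y a)).
- move=> i d d' h hd' y hy; apply: shrink_radius (hd') (h y _); [exact: Rabs_pos | lra].
- by move=> j; exact: Ck1_lipschitz_at (hG1 j).
have hn := pos_INR n.
pose d1 := Rmin d0 (d / (INR n + 1)).
have hdn : 0 < d / (INR n + 1) by apply: Rdiv_lt_0_compat; lra.
have hd1 : 0 < d1 by exact: Rmin_pos.
have hdd : d / (INR n + 1) * (INR n + 1) = d by field; lra.
have hd1d : d1 <= d by have := Rmin_r d0 (d / (INR n + 1)); rewrite -/d1; nra.
exists (fun j => G j a), d1; split => // x hx.
set N := norm2 (vsub x a) in hx *.
have hN : 0 <= N := norm2_ge0 (vsub x a).
have hinv : 0 < / d by exact: Rinv_0_lt_compat.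
have H : Rabs (F x - F a - dot (fun j => G j a) (vsub x a)) <= / d * N * (INR n * N).
  apply: (mean_value_ineq F G) => [|y hy j]; first by nra.
  split; first by apply/hG/hB; have := Rmin_l d0 (d / (INR n + 1)); rewrite -/d1 -/N in hy *; lra.
  rewrite -/N in hy; have := h j y ltac:(lra) => hj.
  apply: (Rmult_le_reg_l d) => //; rewrite -Rmult_assoc Rinv_r; lra.
apply: (Rle_trans _ (d1 * (/ d * N * (INR n * N)))).
  by apply: Rmult_le_compat_l => //; lra.
have h1 : d1 * (INR n + 1) <= d.
  by rewrite -hdd; apply: Rmult_le_compat_r; [lra | exact: Rmin_r].
have h2 : d1 * INR n <= d by nra.
have -> : d1 * (/ d * N * (INR n * N)) = (d1 * INR n) * / d * N ^ 2 by ring.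
rewrite -[X in _ <= X]Rmult_1_l; apply: Rmult_le_compat_r; first exact: pow2_ge_0.
by rewrite -(Rinv_r d); [apply: Rmult_le_compat_r; lra | lra].
Qed.

Lemma CkV2_taylor {n p} (W : vec n -> Prop) (F : vec n -> vec p) a :
  is_open W -> W a -> CkV 2 W F ->
  exists (J : mat p n) (C rad : R), 0 <= C /\ 0 < rad /\
    forall x, norm2 (vsub x a) < rad ->
      norm2 (vsub (vsub (F x) (F a)) (mapply J (vsub x a))) <= C * norm2 (vsub x a) ^ 2.
Proof.
move=> hW ha hF.
have [J hJ] := choice _ (fun i => Ck2_taylor W (fun x => F x i) a hW ha (hF i)).
have [|d [hd h]] := common_radius _ _ _ hJ.
  move=> i d d' h hd' y hy; apply: shrink_radius (hd') (h y _); [exact: Rabs_pos | lra].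
exists J, (INR p * / d), d; split.
  apply: Rmult_le_pos; first exact: pos_INR.
  exact/Rlt_le/Rinv_0_lt_compat.
split => // x hx; rewrite Rmult_assoc.
apply: norm2_le_coord => [|i].
  apply: Rmult_le_pos; last exact: pow2_ge_0.
  exact/Rlt_le/Rinv_0_lt_compat.
apply: (Rmult_le_reg_l d) => //; rewrite -Rmult_assoc Rinv_r ?Rmult_1_l; last lra.
exact: h.
Qed.

(** * One step of the method *)

(** The affine part of the expansion of [F] commutes with affine combinations, so only the quadratic
    remainders are left: at the combination, within [Gam * eta] of [a], and at the points, weighted
    by the coefficients. *)
Lemma affine_comb_defect {n p} (F : vec n -> vec p) (J : mat p n) (a : vec n)
    (C eta Gam : R) m c (X : nat -> vec n) :
  0 <= C -> csum m c = 1 -> sum_f_R0 (fun i => Rabs (c i)) m <= Gam -> 0 <= eta ->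
  (forall i, (i <= m)%nat -> norm2 (vsub (X i) a) <= eta) ->
  (forall x, (exists2 i, (i <= m)%nat & x = X i) \/ x = lincomb m c X ->
     norm2 (vsub (vsub (F x) (F a)) (mapply J (vsub x a))) <= C * norm2 (vsub x a) ^ 2) ->
  norm2 (vsub (F (lincomb m c X)) (lincomb m c (fun i => F (X i))))
    <= C * ((Gam + Gam ^ 2) * eta ^ 2).
Proof.
move=> hC hc hS heta hX hq.
set S := sum_f_R0 _ _ in hS.
have hS0 : 0 <= S.
  by apply: (Rle_trans _ (Rabs (sum_f_R0 c m))); [exact: Rabs_pos | exact: Rsum_abs].
set xt := lincomb m c X.
pose rem x := vsub (vsub (F x) (F a)) (mapply J (vsub x a)).
have e : vsub (F xt) (lincomb m c (fun i => F (X i)))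
    = vsub (rem xt) (lincomb m c (fun i => rem (X i))).
  rewrite /rem -!vsub_lincomb -mapply_lincomb -vsub_lincomb !(lincomb_const m c) //.
  by apply: functional_extensionality => j; rewrite /vsub -/xt; ring.
have hxt : norm2 (vsub xt a) <= Gam * eta.
  apply: (Rle_trans _ (S * eta)); last exact: Rmult_le_compat_r.
  exact: lincomb_dev hX.
have sq u v : 0 <= u <= v -> u ^ 2 <= v ^ 2 by move=> h; apply: pow_incr.
have h1 : norm2 (rem xt) <= C * (Gam * eta) ^ 2.
  apply: (Rle_trans _ (C * norm2 (vsub xt a) ^ 2)); first by apply: hq; right.
  by apply: Rmult_le_compat_l => //; apply: sq; split=> //; exact: norm2_ge0.
have h2 : norm2 (lincomb m c (fun i => rem (X i))) <= S * (C * eta ^ 2).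
  apply: norm2_lincomb => i hi.
  apply: (Rle_trans _ (C * norm2 (vsub (X i) a) ^ 2)); first by apply: hq; left; exists i.
  apply: Rmult_le_compat_l => //; apply: sq; split; [exact: norm2_ge0 | exact: hX].
have h3 : S * (C * eta ^ 2) <= Gam * (C * eta ^ 2).
  by apply: Rmult_le_compat_r => //; apply: Rmult_le_pos => //; exact: pow2_ge_0.
rewrite e; have := norm2D (rem xt) (vscale (-1) (lincomb m c (fun i => rem (X i)))).
rewrite -vsubE norm2Z Rabs_Ropp Rabs_R1; lra.
Qed.

(** The combination [xt] may leave [Sigma], so the contraction is applied at [PS xt]. The projection
    fixes the points of the window, hence [xt] and [PS xt] differ only to second order, and the
    Lipschitz bounds transfer this to [f] and to [f] after [g]. The constants depend on the window
    only through [Gam]. *)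
Lemma one_step {n p} (Sigma V U : vec n -> Prop) (f : vec n -> vec p)
    (g PS : vec n -> vec n) (xs : vec n) (Jf : mat p n) (Jg : mat n n)
    (Nf Nfg K sigma L L' Gam : R) :
  CkV 2 U PS -> (forall x, V x -> Sigma (g x)) -> Sigma xs -> g xs = xs -> f xs = vzero ->
  0 < K < 1 ->
  (forall x, V x -> V (g x) -> Sigma x -> norm2 (f (g x)) <= K * norm2 (f x)) ->
  0 < sigma ->
  (forall x, V x -> Sigma x -> sigma * norm2 (vsub x xs) <= norm2 (f x)) ->
  is_open U -> U xs -> (forall x, U x -> V x /\ V (g x)) -> 0 <= Nf -> 0 <= Nfg ->
  (forall x y, U x -> U y ->
     norm2 (vsub (f x) (f y)) <= 2 * Nf * norm2 (vsub x y) /\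
     norm2 (vsub (f (g x)) (f (g y))) <= 2 * Nfg * norm2 (vsub x y)) ->
  0 <= L -> 0 <= L' ->
  (forall x, U x ->
     norm2 (vsub (f x) (mapply Jf (vsub x xs))) <= L / 2 * norm2 (vsub x xs) ^ 2 /\
     norm2 (vsub (vsub (g x) xs) (mapply Jg (vsub x xs)))
       <= L' / 2 * norm2 (vsub x xs) ^ 2) ->
  (forall x, U x -> Sigma (PS x) /\ U (PS x)) ->
  (forall x, U x -> Sigma x -> PS x = x) ->
  0 <= Gam ->
  exists e0 C, 0 < e0 /\ 0 <= C /\
  forall m c X e, 0 <= e <= e0 -> csum m c = 1 ->
    sum_f_R0 (fun i => Rabs (c i)) m <= Gam ->
    (forall i, (i <= m)%nat -> V (X i) /\ Sigma (X i) /\ norm2 (f (X i)) <= e) ->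
    U (lincomb m c X) /\
    forall y, y = g (lincomb m c X) \/
        (forall x, Sigma x) /\ y = lincomb m c (fun i => g (X i)) ->
      V y /\ Sigma y /\
      norm2 (f y) <= K * norm2 (lincomb m c (fun i => f (X i))) + C * e ^ 2.
Proof.
move=> hPS hgS hxsS hgxs hfxs hK hA1 hs hA2 hUo hUxs hUV hNf hNfg hLip hL hL' hquad
  hproj hfix hGam.
have [JP [CP [rad [hCP [hrad hT]]]]] := CkV2_taylor U PS xs hUo hUxs hPS.
have [d0 [hd0 hB0]] := hUo xs hUxs.
pose d := Rmin d0 rad; have hd : 0 < d by exact: Rmin_pos.
have hB x : norm2 (vsub x xs) < d -> U x.
  by move=> hx; apply: hB0; have := Rmin_l d0 rad; rewrite -/d; lra.
(* Chosen so that [q * eta <= d / 2] puts the window, its affine combinations and the image [g xt]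
   within distance [d] of [xs]. *)
pose q := (Gam + 1) * (1 + 2 * Nf / sigma).
have hNs : 0 <= 2 * Nf / sigma by apply: Rle_mult_inv_pos; lra.
have hq : 0 < q by apply: Rmult_lt_0_compat; lra.
(* The terms stem, in order, from replacing [f xt] by the combined residuals, from replacing [xt] by
   [PS xt] under [f] and under [f] after [g], and, for version A, from exchanging [g] with the
   combination. *)
pose A := L / 2 + 2 * Nf * CP + 2 * Nfg * CP + 2 * Nf * (L' / 2).
have [hNC hNgC] := (Rmult_le_pos _ _ hNf hCP, Rmult_le_pos _ _ hNfg hCP).
have hNL := Rmult_le_pos _ _ hNf hL'.
have hA : 0 <= A by rewrite /A; lra.
exists (sigma * d / (2 * q)), (A * (Gam + Gam ^ 2) / sigma ^ 2).
have hG2 : 0 <= Gam ^ 2 by exact: pow2_ge_0.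
split; first by apply: Rdiv_lt_0_compat; [exact: Rmult_lt_0_compat | lra].
split.
  apply: Rle_mult_inv_pos; last exact: pow_lt.
  by apply: Rmult_le_pos; lra.
move=> m c X e [he0 he] hc hS hX.
pose eta := e / sigma.
have heta0 : 0 <= eta by exact: Rle_mult_inv_pos.
have heta : q * eta <= d / 2.
  apply: (Rle_trans _ (q * (sigma * d / (2 * q) / sigma))); last first.
    by apply: Req_le; field; lra.
  apply: Rmult_le_compat_l; first lra.
  by apply: Rmult_le_compat_r => //; apply/Rlt_le/Rinv_0_lt_compat.
have eeta : sigma * eta = e by rewrite /eta; field; lra.
have hGe : Gam * eta < d /\ eta < d /\ 2 * Nf / sigma * (Gam * eta) < d.
  have h1 := Rmult_le_pos _ _ hGam heta0.
  have h2 := Rmult_le_pos _ _ hNs heta0; have h3 := Rmult_le_pos _ _ hNs h1.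
  by move: heta; rewrite /q; split; [|split]; lra.
have [hGe1 [hGe2 hGe3]] := hGe.
have near y b : V y -> Sigma y -> norm2 (f y) <= sigma * b -> norm2 (vsub y xs) <= b.
  by move=> h1 h2 h3; have := hA2 y h1 h2 => h4; apply: (Rmult_le_reg_l sigma) => //; lra.
have hXn i : (i <= m)%nat -> norm2 (vsub (X i) xs) <= eta.
  by move=> /hX [h1 [h2 h3]]; apply: near; rewrite ?eeta.
have hXU i : (i <= m)%nat -> U (X i) by move=> /hXn h; apply: hB; lra.
set S := sum_f_R0 _ _ in hS.
have devle (Y : nat -> vec n) : (forall i, (i <= m)%nat -> norm2 (vsub (Y i) xs) <= eta) ->
    norm2 (vsub (lincomb m c Y) xs) <= Gam * eta.
  move=> h; apply: (Rle_trans _ (S * eta)); last exact: Rmult_le_compat_r.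
  exact: lincomb_dev h.
set xt := lincomb m c X.
have hxt : norm2 (vsub xt xs) <= Gam * eta := devle X hXn.
have hxtU : U xt by apply: hB; lra.
have vs0 (v : vec p) : vsub v vzero = v.
  by apply: functional_extensionality => j; rewrite /vsub /vzero; ring.
set Q := (Gam + Gam ^ 2) * eta ^ 2.
have hX1 x : (exists2 i, (i <= m)%nat & x = X i) \/ x = lincomb m c X ->
    U x /\ norm2 (vsub x xs) < d.
  case=> [[i hi ->]|->]; last by split => //; rewrite -/xt; lra.
  by split; [exact: hXU | have := hXn i hi; lra].
have defP : norm2 (vsub xt (PS xt)) <= CP * Q.
  have : norm2 (vsub (PS xt) (lincomb m c (fun i => PS (X i)))) <= CP * Q.
    apply: (affine_comb_defect PS JP xs) => // x /hX1 [_ hx].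
    by apply: hT; have := Rmin_r d0 rad; rewrite -/d; lra.
  (* The [X i] lie on [Sigma], where [PS] is the identity. *)
  rewrite norm2_subC; suff -> : lincomb m c (fun i => PS (X i)) = xt by [].
  apply: functional_extensionality => j; apply: sumR_ext => i hi.
  by rewrite hfix //; [exact: hXU | have [_ []] := hX i hi].
have deff : norm2 (vsub (f xt) (lincomb m c (fun i => f (X i)))) <= L / 2 * Q.
  apply: (affine_comb_defect f Jf xs) => //; first lra.
  by move=> x /hX1 [hx _]; rewrite hfxs vs0; have [] := hquad x hx.
have defg : norm2 (vsub (g xt) (lincomb m c (fun i => g (X i)))) <= L' / 2 * Q.
  apply: (affine_comb_defect g Jg xs) => //; first lra.
  by move=> x /hX1 [hx _]; rewrite hgxs; have [] := hquad x hx.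
have hQ : 0 <= Q by apply: Rmult_le_pos; [lra | exact: pow2_ge_0].
set rho := lincomb m c (fun i => f (X i)) in deff *.
have [hhS hhU] := hproj xt hxtU; have [hhV hhgV] := hUV _ hhU.
have [l1 l2] := hLip _ _ hxtU hhU.
have boundP : norm2 (f (g xt)) <= K * norm2 rho
    + (L / 2 + 2 * Nf * CP + 2 * Nfg * CP) * Q.
  have b1 := norm2_le_add (f (g xt)) (f (g (PS xt))).
  have b2 := hA1 _ hhV hhgV hhS.
  have b3 := norm2_le_add (f (PS xt)) (f xt); rewrite norm2_subC in b3.
  have b4 := norm2_le_add (f xt) rho.
  have b5 := Rmult_le_compat_l (2 * Nf) _ _ ltac:(lra) defP.
  have b6 := Rmult_le_compat_l (2 * Nfg) _ _ ltac:(lra) defP.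
  have b7 : K * norm2 (f (PS xt)) <= K * norm2 rho + (L / 2 * Q + 2 * Nf * (CP * Q)).
    have h8 : norm2 (f (PS xt)) <= norm2 rho + (L / 2 * Q + 2 * Nf * (CP * Q)) by lra.
    have h9 : 0 <= L / 2 * Q + 2 * Nf * (CP * Q).
      have := Rmult_le_pos _ _ hNC hQ; have := Rmult_le_pos _ _ hL hQ; lra.
    have := Rmult_le_compat_l K _ _ ltac:(lra) h8; nra.
  lra.
have eCe : A * (Gam + Gam ^ 2) / sigma ^ 2 * e ^ 2 = A * Q.
  by rewrite /Q /eta; field; lra.
have hNLQ := Rmult_le_pos _ _ hNL hQ.
rewrite eCe; split=> // y [->|[hfull ->]].
  have [hV1 hV2] := hUV _ hxtU; split=> //; split; first exact: hgS.
  by move: boundP; rewrite /A; lra.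
(* From here on version A. The contraction keeps the images of the window within [eta] of [xs]. *)
have hgX i : (i <= m)%nat -> norm2 (vsub (g (X i)) xs) <= eta.
  move=> hi; have [h1 [h2 h3]] := hX i hi; have [h4 h5] := hUV _ (hXU i hi).
  apply: near => //; rewrite eeta; have := hA1 _ h1 h5 h2.
  by have := norm2_ge0 (f (X i)); nra.
have hyU : U (lincomb m c (fun i => g (X i))).
  by apply: hB; have := devle (fun i => g (X i)) hgX; lra.
have [hyV _] := hUV _ hyU; split=> //; split=> //.
have [hxtV hgxtV] := hUV _ hxtU.
(* Needed to use the Lipschitz bound of [f] between [g xt] and the combined images. The distance of
   [g xt] to [xs] is controlled by its residual, at most that of [xt], itself at most
   [2 * Nf * (Gam * eta)]. *)
have hgxtU : U (g xt).
  apply: hB; apply: (Rle_lt_trans _ (2 * Nf / sigma * (Gam * eta))) => //.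
  apply: near => //.
  have := hA1 _ hxtV hgxtV (hfull _); have [+ _] := hLip _ _ hxtU hUxs.
  rewrite hfxs vs0 => h1 h2; have h3 := norm2_ge0 (f xt).
  have h4 := Rmult_le_compat_l (2 * Nf) _ _ ltac:(lra) hxt.
  have -> : sigma * (2 * Nf / sigma * (Gam * eta)) = 2 * Nf * (Gam * eta) by field; lra.
  nra.
have [h1 _] := hLip _ _ hyU hgxtU; rewrite (norm2_subC (lincomb _ _ _)) in h1.
have := norm2_le_add (f (lincomb m c (fun i => g (X i)))) (f (g xt)).
have := Rmult_le_compat_l (2 * Nf) _ _ ltac:(lra) defg.
rewrite /A; lra.
Qed.

(** * Runs of the method *)

Lemma lincomb_ext {n} m c (X Y : nat -> vec n) :
  (forall i, (i <= m)%nat -> X i = Y i) -> lincomb m c X = lincomb m c Y.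
Proof.
by move=> h; apply: functional_extensionality => j; apply: sumR_ext => i /h ->.
Qed.

Lemma ap_coef_ext {p} m (Rs Rs' : nat -> vec p) c :
  (forall i, (i <= m)%nat -> Rs i = Rs' i) -> is_ap_coef m Rs c -> is_ap_coef m Rs' c.
Proof.
by move=> h [h1 h2]; split=> // c'; rewrite -!(lincomb_ext m _ Rs Rs') //; exact: h2.
Qed.

(** * Existence of a run *)

Lemma bounded_max_exists (P : nat -> Prop) B : P 0%nat ->
  exists m, (m <= B)%nat /\ P m /\ forall mm, (m < mm)%nat -> (mm <= B)%nat -> ~ P mm.
Proof.
move=> h0; elim: B => [|B [m [h1 [h2 h3]]]].
  by exists 0%nat; split=> //; split=> // mm; lia.
have [hP|hP] := classic (P B.+1).
  by exists B.+1; split=> //; split=> // mm; lia.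
exists m; split; first lia; split=> // mm hm; rewrite leq_eqVlt => /orP [/eqP -> //|].
by rewrite ltnS; exact: h3.
Qed.

(** One step as a relation between whole histories, so that runs can be built by recursion.
    Histories are total functions; only [X] up to [k] and [X'] up to [k + 1] matter. *)
Definition ap_next {n p} (f : vec n -> vec p) (g : vec n -> vec n) (delta : R)
    (ver : ap_version) (k : nat) (X : nat -> vec n) (m : nat)
    (X' : nat -> vec n) (m' : nat) (c : nat -> R) : Prop :=
  (forall i, (i <= k)%nat -> X' i = X i) /\
  (f (X k) = vzero -> X' k.+1 = X k) /\
  (f (X k) <> vzero -> m = 0%nat -> c 0%nat = 1 /\ X' k.+1 = g (X k)) /\
  (f (X k) <> vzero -> m <> 0%nat ->
     is_ap_coef m (fun i => f (X (k - m + i)%nat)) c /\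
     X' k.+1 = match ver with
               | VersionP => g (lincomb m c (fun i => X (k - m + i)%nat))
               | VersionA => lincomb m c (fun i => g (X (k - m + i)%nat))
               end) /\
  (m' <= m.+1)%nat /\ depth_ok delta (fun i => f (X' i)) k m' /\
  forall mm, (m' < mm)%nat -> (mm <= m.+1)%nat ->
    ~ depth_ok delta (fun i => f (X' i)) k mm.

Lemma ap_next_exists {n p} (f : vec n -> vec p) g delta ver k X m :
  exists s : (nat -> vec n) * nat * (nat -> R),
    ap_next f g delta ver k X m s.1.1 s.1.2 s.2.
Proof.
have [c [y hy]] : exists c y, (f (X k) = vzero -> y = X k) /\
  (f (X k) <> vzero -> m = 0%nat -> c 0%nat = 1 /\ y = g (X k)) /\
  (f (X k) <> vzero -> m <> 0%nat ->
     is_ap_coef m (fun i => f (X (k - m + i)%nat)) c /\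
     y = match ver with
         | VersionP => g (lincomb m c (fun i => X (k - m + i)%nat))
         | VersionA => lincomb m c (fun i => g (X (k - m + i)%nat))
         end).
  have [h0|h0] := classic (f (X k) = vzero); first by exists (fun=> 1), (X k).
  have [->|hm] := eqVneq m 0%nat; first by exists (fun=> 1), (g (X k)).
  have [c hc] := ap_coef_exists m (fun i => f (X (k - m + i)%nat)).
  exists c, match ver with
    | VersionP => g (lincomb m c (fun i => X (k - m + i)%nat))
    | VersionA => lincomb m c (fun i => g (X (k - m + i)%nat))
    end.
  by split=> //; split=> [_ h|_ _]; [rewrite h in hm | split].
pose X' i := if (i <= k)%nat then X i else y.
(* Depth 0 is always admissible, its range of indices being empty. *)
have [|m' [h1 [h2 h3]]] := bounded_max_exists (depth_ok delta (fun i => f (X' i)) k) m.+1.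
  by move=> i; lia.
exists (X', m', c); split => /=; first by move=> i; rewrite /X' => ->.
have -> : X' k.+1 = y by rewrite /X' ltnn.
by have [hy1 [hy2 hy3]] := hy; do 4!split=> //.
Qed.

(** A chosen successor is iterated on states made of history, depth and coefficients, and the run is
    the diagonal of the histories. *)
Lemma ap_run_exists {n p} (f : vec n -> vec p) g delta ver x0 :
  exists x r m c, ap_run f g delta ver x0 x r m c.
Proof.
have [F hF] := choice _ (fun a : nat * (nat -> vec n) * nat =>
  ap_next_exists f g delta ver a.1.1 a.1.2 a.2).
pose st := nat_rect (fun=> (nat -> vec n) * nat * (nat -> R))%type
  (fun=> x0, 0%nat, fun=> 0) (fun k s => F (k, s.1.1, s.1.2)).
have hst k : ap_next f g delta ver k (st k).1.1 (st k).1.2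
    (st k.+1).1.1 (st k.+1).1.2 (st k.+1).2 by exact: (hF (k, (st k).1.1, (st k).1.2)).
(* The coefficients of step [k] are produced together with state [k + 1], hence the shift; those of
   state 0 are a placeholder. *)
pose x k := (st k).1.1 k; pose m k := (st k).1.2; pose c k := (st k.+1).2.
have hx i k : (i <= k)%nat -> (st k).1.1 i = x i.
  elim: k => [|k IH]; first by rewrite leqn0 => /eqP ->.
  rewrite leq_eqVlt => /orP [/eqP -> //|]; rewrite ltnS => hi.
  by have [h _] := hst k; rewrite h //; exact: IH.
have hm k : (m k <= k)%nat.
  elim: k => // k IH; have [_ [_ [_ [_ [+ _]]]]] := hst k; rewrite -/(m k) -/(m k.+1); lia.
have hd k mm : depth_ok delta (fun i => f ((st k.+1).1.1 i)) k mm
    <-> depth_ok delta (fun i => f (x i)) k mm.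
  by split=> h i h1 h2; have := h i h1 h2; rewrite !hx //; lia.
exists x, (fun k => f (x k)), m, c; do 3!split=> //.
split=> [k h|]; first by have [_ [+ _]] := hst k; exact.
split=> [k h|]; first by have [_ [_ [+ _]]] := hst k; exact.
split=> [k h hm0|k].
  have [_ [_ [_ [+ _]]]] := hst k; rewrite -/(x k) -/(x k.+1) -/(m k) -/(c k).
  move=> /(_ h hm0) [h1 ->].
  have hw i : (i <= m k)%nat -> (st k).1.1 (k - m k + i)%nat = x (k - m k + i)%nat.
    by move=> hi; apply: hx; have := hm k; lia.
  split; first by apply: ap_coef_ext h1 => i /hw ->.
  by case: (ver); [congr g|]; apply: lincomb_ext => i /hw ->.
have [_ [_ [_ [_ [h1 [/hd h2 h3]]]]]] := hst k.
by split=> //; split=> // mm l1 l2 /hd; exact: h3.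
Qed.

(** * Residuals and coefficients along a run *)

Definition residual_comb {p} (r : nat -> vec p) (m : nat -> nat) (c : nat -> nat -> R)
    (k : nat) : vec p :=
  lincomb (m k) (c k) (fun i => r (k - m k + i)%nat).

Section Run.

Context {n p : nat} {f : vec n -> vec p} {g : vec n -> vec n} {delta : R}.
Context {ver : ap_version} {x0 : vec n} {x : nat -> vec n} {r : nat -> vec p}.
Context {m : nat -> nat} {c : nat -> nat -> R}.
Hypothesis run : ap_run f g delta ver x0 x r m c.

Lemma run_residual k : r k = f (x k).
Proof. by have [_ [_ [h _]]] := run. Qed.

Lemma run_frozen k : r k = vzero -> x k.+1 = x k /\ r k.+1 = vzero.
Proof.
have [_ [_ [hr [h _]]]] := run => h0; split; first exact: h.
by rewrite hr h // -hr.
Qed.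

Lemma run_depthS k : (m k.+1 <= (m k).+1)%nat.
Proof. by have [_ [_ [_ [_ [_ [_ h]]]]]] := run; have [] := h k. Qed.

Lemma run_depth_le k : (m k <= k)%nat.
Proof.
elim: k => [|k IH]; first by have [_ [-> _]] := run.
have := run_depthS k; lia.
Qed.

(** The depth grows by at most one per step, so the left end of the window never moves back. Thus
    for [j] in the window of [k], the window of [j] contains all earlier points of the window of
    [k]. *)
Lemma run_window_mono j k : (j <= k)%nat -> (j - m j <= k - m k)%nat.
Proof.
elim: k => [|k IH]; first by rewrite leqn0 => /eqP ->.
rewrite leq_eqVlt => /orP [/eqP -> //|]; rewrite ltnS => /IH.
have := run_depthS k; have := run_depth_le k; lia.
Qed.

Lemma run_depth_ok k : m k.+1 <> 0%nat -> delta * norm2 (r k) < norm2 (r k.+1).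
Proof.
have [_ [_ [_ [_ [_ [_ h]]]]]] := run; have [_ [hd _]] := h k => hm.
by apply: hd => //; lia.
Qed.

Lemma run_window_residual k i : 0 < delta <= 1 -> (k - m k <= i <= k)%nat ->
  delta * norm2 (r i) <= norm2 (r k).
Proof.
move=> hdel /andP [h1 h2].
have hn := norm2_ge0 (r k).
move: h2; rewrite leq_eqVlt => /orP [/eqP ->|h2]; first by nra.
case: k h1 h2 {hn} => [//|k] h1 h2; apply: Rlt_le.
have [_ [_ [_ [_ [_ [_ h]]]]]] := run; have [_ [hd _]] := h k.
by apply: hd; lia.
Qed.

(* A step of depth 0 is the least-squares step over a one-point window. *)
Lemma run_step k : r k <> vzero ->
  is_ap_coef (m k) (fun i => r (k - m k + i)%nat) (c k) /\
  x k.+1 = match ver with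
           | VersionP => g (lincomb (m k) (c k) (fun i => x (k - m k + i)%nat))
           | VersionA => lincomb (m k) (c k) (fun i => g (x (k - m k + i)%nat))
           end.
Proof.
have [_ [_ [_ [_ [h1 [h2 _]]]]]] := run => h0.
have [hm|/eqP hm] := eqVneq (m k) 0%nat; last exact: h2.
have {h1} [hc ->] := h1 k h0 hm; rewrite hm.
have e q d (X : nat -> vec q) : d 0%nat = 1 -> lincomb 0 d X = X 0%nat.
  by move=> hd; apply: functional_extensionality => j; rewrite /lincomb /= hd Rmult_1_l.
split; last by case: (ver); rewrite e // subn0 addn0.
by split=> // c' hc'; rewrite !e //; exact: Rle_refl.
Qed.

Lemma run_window_orth k s j : r k <> vzero -> (k - m k <= s)%nat -> (s + j <= k)%nat ->
  dot (r (s + j)%nat) (residual_comb r m c k)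
  = dot (residual_comb r m c k) (residual_comb r m c k).
Proof.
move=> h0 h1 h2; have [hc _] := run_step k h0.
have := ap_coef_orth _ _ _ (s + j - (k - m k)) hc.
by rewrite subnKC; last lia; apply; have := run_depth_le k; lia.
Qed.

Lemma run_residual_comb_le k i : r k <> vzero -> (k - m k <= i <= k)%nat ->
  norm2 (residual_comb r m c k) <= norm2 (r i).
Proof.
move=> h0 h1; have [hc _] := run_step k h0.
have := ap_coef_norm_le _ _ _ (i - (k - m k)) hc.
by rewrite subnKC; last lia; apply; have := run_depth_le k; lia.
Qed.

(** If the depth has just grown by one, the left end is unchanged and the bound is inherited,
    residuals being nonincreasing. Otherwise one more unit of depth was permitted and rejected by
    maximality, and only the point just before the window can be the cause. *)
Lemma run_restart k : (forall j, (j < k)%nat -> norm2 (r j.+1) <= norm2 (r j)) ->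
  (1 <= k - m k)%nat -> norm2 (r k) <= delta * norm2 (r (k - m k - 1)%nat).
Proof.
elim: k => [//|k IH] hmono hk.
have [e|hne] := eqVneq (m k.+1) (m k).+1.
  rewrite e subSS in hk *; apply: (Rle_trans _ (norm2 (r k))); first exact: hmono.
  by apply: IH => // j hj; apply: hmono; lia.
have [_ [_ [_ [_ [_ [_ h]]]]]] := run; have [h1 [h2 h3]] := h k.
apply: Rnot_lt_le => hlt.
apply: (h3 (m k.+1).+1) => [//||i hi1 hi2]; first by rewrite ltn_neqAle hne.
have [hi|hi] := leqP (k.+1 - m k.+1) i; first exact: h2.
by have -> : i = (k.+1 - m k.+1 - 1)%nat by lia.
Qed.

(* The triangular system behind both bounds: each residual r_(s+j) of the
   window is at most mu times the least-squares residual of the preceding step,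
   which is orthogonal to all differences of earlier residuals of the window. *)
Lemma run_coef_bound mu k : 0 < mu < 1 -> r k <> vzero ->
  (forall j, (j < k)%nat -> norm2 (r j.+1) <= norm2 (r j)) ->
  (forall j, (j < k)%nat -> m j.+1 <> 0%nat ->
     norm2 (r j.+1) <= mu * norm2 (residual_comb r m c j)) ->
  (m k <= p)%nat /\
  sum_f_R0 (fun i => Rabs (c k i)) (m k) <= 2 * (1 + 2 / (1 - mu)) ^ m k - 1.
Proof.
move=> hmu h0 hmono hrho.
have mono i j : (i <= j <= k)%nat -> norm2 (r j) <= norm2 (r i).
  elim: j => [|j IH]; first by rewrite leqn0 => /andP [/eqP -> _]; exact: Rle_refl.
  case/andP; rewrite leq_eqVlt => /orP [/eqP -> _|hi hj]; first exact: Rle_refl.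
  by apply: Rle_trans (hmono j _) (IH _); lia.
have rpos i : (i <= k)%nat -> 0 < norm2 (r i).
  by move=> hi; apply: Rlt_le_trans (norm2_gt0 _ h0) (mono _ _ _); lia.
have rne i : (i <= k)%nat -> r i <> vzero.
  by move=> /rpos + e; rewrite e norm2_vzero; exact: Rlt_irrefl.
set s := (k - m k)%nat.
have hs : (s + m k = k)%nat by have := run_depth_le k; rewrite /s; lia.
(* [w j] belongs to the step that produced [r (s + j)]; it is used for [j >= 1] only. *)
pose w j := residual_comb r m c (s + j.-1)%nat.
have orth i j : (i < j <= m k)%nat -> dot (r (s + i)%nat) (w j) = dot (w j) (w j).
  move=> hij; apply: run_window_orth; [by apply: rne; lia | | lia].
  by have := run_window_mono (s + j.-1) k; rewrite -/s; lia.
have small i j : (0 < j)%nat -> (j <= i <= m k)%nat ->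
    norm2 (r (s + i)%nat) <= mu * norm2 (w j).
  move=> hj hij; apply: (Rle_trans _ (norm2 (r (s + j)%nat))); first by apply: mono; lia.
  rewrite /w; case: j hj hij => [//|j] _ hij; rewrite addnS.
  apply: hrho; first lia.
  (* The window of [s + j + 1] starts no later than [s], so its depth is positive and the sharper
     estimate [hrho] is available. *)
  by have := run_window_mono (s + j).+1 k; rewrite -/s; lia.
have wpos j : (0 < j <= m k)%nat -> 0 < norm2 (w j).
  move=> hj; have := small j j ltac:(lia) ltac:(lia); have := rpos (s + j)%nat ltac:(lia).
  have := norm2_ge0 (w j); nra.
have w2pos j : (0 < j <= m k)%nat -> 0 < dot (w j) (w j).
  by move=> /wpos h; rewrite -norm2_sq; nra.
have diag i j : (0 < j)%nat -> (j <= i <= m k)%nat ->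
    Rabs (dot (r (s + i)%nat) (w j)) <= mu * dot (w j) (w j).
  move=> hj hij; apply: (Rle_trans _ _ _ (cauchy_schwarz _ _)).
  rewrite -norm2_sq; have := small i j hj hij; have := norm2_ge0 (w j); nra.
split.
  (* Differences with the first residual vanish against later [w]; on the diagonal the product is at
     most [(mu - 1) (w.w) < 0]. *)
  apply: (staircase_le_dim p (m k) (fun i => vsub (r (s + i.+1)%nat) (r (s + 0)%nat))
    (fun i => w i.+1)) => [i j hij|i].
    by rewrite dotBl !orth; [ring | have := ltn_ord j; lia | have := ltn_ord j; lia].
  rewrite dotBl (orth 0%nat); last by have := ltn_ord i; lia.
  have := diag i.+1 i.+1 isT ltac:(have := ltn_ord i; lia).
  have := w2pos i.+1 ltac:(have := ltn_ord i; lia).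
  have := Rle_abs (dot (r (s + i.+1)%nat) (w i.+1)); nra.
have [[hc _] _] := run_step k h0.
rewrite -[X in _ <= X]Rmult_1_r.
(* Row [j] tests the combined residual against [w j], normalised so that the entries left of the
   diagonal are 1. *)
apply: (coef_sum_bound mu _ _ (fun i j => dot (r (s + i)%nat) (w j) / dot (w j) (w j))).
- by case: hmu.
- by rewrite hc Rabs_R1; exact: Rle_refl.
move=> j hj; have hw := w2pos j hj.
have divle a b : a <= b * dot (w j) (w j) -> a / dot (w j) (w j) <= b.
  move=> h; apply: (Rmult_le_reg_r (dot (w j) (w j))) => //.
  by rewrite /Rdiv Rmult_assoc Rinv_l; lra.
have absdiv a : Rabs (a / dot (w j) (w j)) = Rabs a / dot (w j) (w j).
  by rewrite /Rdiv Rabs_mult (Rabs_pos_eq (/ _)) //; apply/Rlt_le/Rinv_0_lt_compat.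
split; first by move=> i hi; rewrite orth; [field; lra | lia].
split.
  apply: divle; have := diag j j ltac:(lia) ltac:(lia).
  have := Rle_abs (dot (r (s + j)%nat) (w j)); lra.
split=> [i hi|].
  by rewrite absdiv; apply: divle; have := diag i j ltac:(lia) ltac:(lia); nra.
(* The row sum is the product of the least-squares residual of step [k] with the normalised [w j],
   bounded by 1 since that residual is at most [r k] in norm, hence at most [mu] times [w j]. *)
rewrite (sumR_ext _ (fun i => c k i * dot (r (s + i)%nat) (w j) * / dot (w j) (w j))); last first.
  by move=> i _; rewrite /Rdiv Rmult_assoc.
rewrite -PartSum.scal_sum Rmult_comm.
rewrite -(dot_lincomb (m k) (c k) (fun i => r (s + i)%nat)) -/(residual_comb r m c k).
rewrite -/(Rdiv _ _) absdiv; apply: divle; rewrite Rmult_1_l.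
apply: (Rle_trans _ _ _ (cauchy_schwarz _ _)); rewrite -norm2_sq.
apply: Rmult_le_compat_r; first exact: norm2_ge0.
have := run_residual_comb_le k k h0 ltac:(rewrite /s in hs *; lia).
have := small (m k) j ltac:(lia) ltac:(lia); rewrite hs; have := norm2_ge0 (w j); nra.
Qed.

End Run.

(** * Choice of the constant and induction over the steps *)

Lemma opnorm_ge0 {p n} (A : mat p n) N : is_opnorm A N -> 0 <= N.
Proof.
move=> [h _]; apply: (Rle_trans _ (norm2 (mapply A vzero))); first exact: norm2_ge0.
by apply: h; exists vzero; split=> //; rewrite norm2_vzero; lra.
Qed.

Theorem theorem3p2 :
  exists Cm : nat -> R, (forall mm, 0 < Cm mm) /\
  forall (n p : nat) (Sigma V U : vec n -> Prop)
    (f : vec n -> vec p) (g : vec n -> vec n) (xs : vec n)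
    (Jf : mat p n) (Jg : mat n n) (Nf Nfg K sigma L L' M : R)
    (PS : vec n -> vec n),
  (* standing assumptions *)
  is_smooth_submanifold Sigma ->
  is_open V ->
  CkV 2 V f ->
  CkV 2 V g -> (forall x, V x -> Sigma (g x)) ->
  V xs -> Sigma xs -> g xs = xs -> f xs = vzero ->
  (* Assumption 1 *)
  0 < K < 1 ->
  (forall x, V x -> V (g x) -> Sigma x -> norm2 (f (g x)) <= K * norm2 (f x)) ->
  (* Assumption 2 *)
  0 < sigma ->
  (forall x, V x -> Sigma x -> sigma * norm2 (vsub x xs) <= norm2 (f x)) ->
  (* the neighbourhood U *)
  is_open U -> U xs -> (forall x, U x -> V x /\ V (g x)) ->
  is_jacobian f xs Jf -> is_jacobian g xs Jg ->
  is_opnorm Jf Nf -> is_opnorm (mmul Jf Jg) Nfg ->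
  (* (i) *)
  (forall x y, U x -> U y ->
     norm2 (vsub (f x) (f y)) <= 2 * Nf * norm2 (vsub x y) /\
     norm2 (vsub (f (g x)) (f (g y))) <= 2 * Nfg * norm2 (vsub x y)) ->
  (* (ii) *)
  0 < L -> 0 < L' ->
  (forall x, U x ->
     norm2 (vsub (f x) (mapply Jf (vsub x xs))) <= L / 2 * norm2 (vsub x xs) ^ 2 /\
     norm2 (vsub (vsub (g x) xs) (mapply Jg (vsub x xs)))
       <= L' / 2 * norm2 (vsub x xs) ^ 2) ->
  (* (iii) *)
  (forall x, U x ->
     (Sigma (PS x) /\ U (PS x) /\
      (forall y, Sigma y -> norm2 (vsub x (PS x)) <= norm2 (vsub x y)) /\
      (forall y, Sigma y -> norm2 (vsub x y) <= norm2 (vsub x (PS x)) -> y = PS x))) ->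
  Cinf U PS ->
  0 < M ->
  (forall x w, U x -> is_orth_proj (tangent_vec Sigma xs) (vsub x xs) w ->
     norm2 (vsub (PS x) (vadd xs w)) <= M / 2 * norm2 (vsub x xs) ^ 2) ->
  (* conclusion *)
  forall mu, K < mu < 1 ->
  exists cmu, 0 < cmu /\
  forall delta, 0 < delta < K ->
  forall (ver : ap_version), (ver = VersionA -> forall x, Sigma x) ->
  forall x0, U x0 -> Sigma x0 ->
  0 < norm2 (f x0) <= cmu * delta ^ 2 ->
  (exists x r m c, ap_run f g delta ver x0 x r m c) /\
  (forall x r m c, ap_run f g delta ver x0 x r m c ->
     (forall k, V (x k)) /\
     (forall k, ver = VersionP -> r k <> vzero -> m k <> 0%nat ->
        V (lincomb (m k) (c k) (fun i => x (k - m k + i)%nat))) /\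
     (forall k, r k <> vzero ->
        (m k <= k)%nat /\ (m k <= p)%nat /\
        (forall i, (i <= m k)%nat ->
           Rabs (c k i) <= Cm (m k) * (1 + (mu / (1 - mu)) ^ (m k))) /\
        norm2 (r k.+1) <= mu * norm2 (r k)) /\
     (forall k, (1 <= k - m k)%nat ->
        norm2 (r k) <= delta * norm2 (r (k - m k - 1)%nat))).
Proof.
exists (fun mm => 2 * 5 ^ mm); split; first by move=> mm; have := pow_lt 5 mm; lra.
move=> n p Sigma V U f g xs Jf Jg Nf Nfg K sigma L L' M PS _ _ _ _ hgS _ hxsS hgxs hfxs
  hK hA1 hs hA2 hUo hUxs hUV _ _ hNf hNfg hLip hL hL' hquad hP hCinf _ _ mu hmu.
(* A point of [Sigma] is at distance zero from itself, so uniqueness of the nearest point identifies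
   it with its projection. *)
have hfix x : U x -> Sigma x -> PS x = x.
  move=> hx hSx; have [_ [_ [_ h]]] := hP x hx; apply/esym/h => //.
  rewrite (_ : vsub x x = vzero) ?norm2_vzero; first exact: norm2_ge0.
  by apply: functional_extensionality => j; exact: Rminus_diag.
(* [Gam] bounds the absolute coefficient sums for all depths up to [p]. It is fixed before [delta]
   and the run, which makes [e0] and [C] uniform. *)
pose q := 1 + 2 / (1 - mu); pose Gam := 2 * q ^ p.
have hq : 1 <= q by have := Rdiv_lt_0_compat 2 (1 - mu) ltac:(lra) ltac:(lra); rewrite /q; lra.
have hqp : 1 <= q ^ p by exact: pow_R1_Rle.
have [||||||e0 [C [he0 [hC step]]]] := one_step Sigma V U f g PS xs Jf Jg Nf Nfg K sigma L L' Gam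
  (hCinf 2%nat) hgS hxsS hgxs hfxs hK hA1 hs hA2 hUo hUxs hUV
  (opnorm_ge0 _ _ hNf) (opnorm_ge0 _ _ hNfg) hLip.
- lra.
- lra.
- exact: hquad.
- by move=> x /hP [h1 [h2 _]].
- exact: hfix.
- by rewrite /Gam; lra.
(* The first entry keeps all residuals below [e0], the second gives [C * cm <= mu - K]; [C + 1]
   avoids a zero denominator. *)
pose cm := Rmin e0 ((mu - K) / (C + 1)).
have hcm : 0 < cm by apply: Rmin_pos => //; apply: Rdiv_lt_0_compat; lra.
have hCcm : C * cm <= mu - K.
  have := Rmin_r e0 ((mu - K) / (C + 1)); rewrite -/cm => h.
  have e : (mu - K) / (C + 1) * (C + 1) = mu - K by field; lra.
  have : cm * (C + 1) <= mu - K by rewrite -e; apply: Rmult_le_compat_r; lra.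
  by nra.
exists cm; split=> // delta hdel ver hver x0 hUx0 hSx0 [hr0 hr0c].
split; first exact: ap_run_exists.
move=> x r m c run.
have hr k : r k = f (x k) := run_residual run k.
have hx0 : x 0%nat = x0 by case: run.
set E := norm2 (f x0) in hr0 hr0c.
have hdel2 : delta ^ 2 < 1 by nra.
have hEe0 : E <= e0 by have := Rmin_l e0 ((mu - K) / (C + 1)); rewrite -/cm; nra.
pose rho := residual_comb r m c.
(* The induction invariant: up to [k] it bounds the coefficients of step [k], and this bound in turn
   yields the estimates for [k + 1]. *)
pose good k := (forall j, (j <= k)%nat -> V (x j) /\ Sigma (x j)) /\
  (forall j, (j < k)%nat -> norm2 (r j.+1) <= mu * norm2 (r j) /\
     (m j.+1 <> 0%nat -> norm2 (r j.+1) <= mu * norm2 (rho j))).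
have gmono k : good k -> forall j, (j < k)%nat -> norm2 (r j.+1) <= norm2 (r j).
  by move=> [_ h] j /h [h1 _]; have := norm2_ge0 (r j); nra.
have coefs k : good k -> r k <> vzero -> (m k <= p)%nat /\
    sum_f_R0 (fun i => Rabs (c k i)) (m k) <= 2 * q ^ m k - 1.
  move=> hg h0; apply: (run_coef_bound run mu) => //; first lra.
    exact: gmono.
  by case: hg => _ h j /h [].
have advance k : good k -> r k <> vzero ->
    U (lincomb (m k) (c k) (fun i => x (k - m k + i)%nat)) /\
    V (x k.+1) /\ Sigma (x k.+1) /\ norm2 (r k.+1) <= mu * norm2 (r k) /\
    (m k.+1 <> 0%nat -> norm2 (r k.+1) <= mu * norm2 (rho k)).
  move=> hg h0; have [hmp hcs] := coefs k hg h0; have hmk := run_depth_le run k.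
  have hrk := norm2_gt0 _ h0.
  have hrE j : (j <= k)%nat -> norm2 (r j) <= E.
    elim: j => [|j IH] hj; first by rewrite hr hx0; exact: Rle_refl.
    by apply: Rle_trans (gmono k hg j hj) (IH _); lia.
  (* Two bounds on the residuals of the window: monotonicity gives [E], the depth rule gives
     [norm2 (r k) / delta]. Using each once turns [e^2] into a small multiple of [norm2 (r k)]. *)
  pose e := Rmin E (norm2 (r k) / delta).
  have hrd : 0 < norm2 (r k) / delta by apply: Rdiv_lt_0_compat; lra.
  have he : 0 < e by exact: Rmin_pos.
  have heE : e <= E := Rmin_l _ _.
  have hed : delta * e <= norm2 (r k).
    have -> : norm2 (r k) = delta * (norm2 (r k) / delta) by field; lra.
    by apply: Rmult_le_compat_l; [lra | exact: Rmin_r].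
  have [[hc hmin] hx] := run_step run k h0.
  have hsum : sum_f_R0 (fun i => Rabs (c k i)) (m k) <= Gam.
    have : q ^ m k <= q ^ p by apply: Rle_pow => //; lia.
    by rewrite /Gam; lra.
  have [|hU hy] := step (m k) (c k) (fun i => x (k - m k + i)%nat) e ltac:(lra) hc hsum.
    move=> i hi; have [|h1 h2] := (proj1 hg) (k - m k + i)%nat; first lia.
    split=> //; split=> //; rewrite -hr; apply: Rmin_glb; first by apply: hrE; lia.
    have := run_window_residual run k (k - m k + i)
      ltac:(lra) ltac:(lia) => hw.
    apply: (Rmult_le_reg_l delta); first lra.
    by rewrite (_ : delta * (norm2 (r k) / delta) = norm2 (r k)) //; field; lra.
  have [|hV [hS hn]] := hy (x k.+1).
    by rewrite hx; case: (ver) hver => hver; [left | right; split=> //; exact: hver].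
  split=> //; split=> //; split=> //.
  have erho : lincomb (m k) (c k) (fun i => f (x (k - m k + i)%nat)) = rho k.
    by apply: lincomb_ext => i _; rewrite hr.
  rewrite erho -hr in hn.
  have hrho : norm2 (rho k) <= norm2 (r k).
    by apply: (run_residual_comb_le run) => //; lia.
  have hrho0 := norm2_ge0 (rho k).
  have he2 : e ^ 2 <= cm * delta * norm2 (r k).
    have : e * e <= cm * delta ^ 2 * e by apply: Rmult_le_compat_r; lra.
    have := Rmult_le_compat_l (cm * delta) _ _ ltac:(nra) hed.
    by nra.
  have hCe := Rmult_le_compat_l _ _ _ hC he2.
  (* Used with [z = norm2 (r k)] for the linear rate, and with [z = norm2 (r k.+1)] when [k] stays
     in the next window, for the comparison with [rho k]. *)
  have ub z : 0 <= z -> delta * norm2 (r k) <= z -> C * e ^ 2 <= (mu - K) * z.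
    move=> hz h; apply: (Rle_trans _ (C * cm * (delta * norm2 (r k)))); first lra.
    apply: (Rle_trans _ (C * cm * z)); last exact: Rmult_le_compat_r.
    by apply: Rmult_le_compat_l => //; apply: Rmult_le_pos; lra.
  split.
    have := ub (norm2 (r k)) ltac:(lra) ltac:(nra).
    by have := Rmult_le_compat_l K _ _ ltac:(lra) hrho; lra.
  move=> /(run_depth_ok run) hd.
  have hz := norm2_ge0 (r k.+1).
  have := ub (norm2 (r k.+1)) hz ltac:(lra) => hu.
  have h1 : norm2 (r k.+1) * (1 - (mu - K)) <= K * norm2 (rho k) by lra.
  (* The difference of the two sides is [(mu - K) (1 - mu)]. *)
  have h2 : K <= mu * (1 - (mu - K)) by nra.
  apply: (Rmult_le_reg_r (1 - (mu - K))); first lra.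
  by have := Rmult_le_compat_r _ _ _ hrho0 h2; lra.
have good_all k : good k.
  have [hV0 _] := hUV _ hUx0.
  elim: k => [|k IH].
    by split=> j //; rewrite leqn0 => /eqP ->; rewrite hx0.
  suff [hV [hS hn]] : V (x k.+1) /\ Sigma (x k.+1) /\ norm2 (r k.+1) <= mu * norm2 (r k) /\
    (m k.+1 <> 0%nat -> norm2 (r k.+1) <= mu * norm2 (rho k)).
    case: IH => I1 I2; split=> j.
      by rewrite leq_eqVlt => /orP [/eqP -> //|]; exact: I1.
    by rewrite ltnS leq_eqVlt => /orP [/eqP -> //|]; exact: I2.
  (* After termination the iterate is frozen and both estimates hold trivially. *)
  have [h0|h0] := classic (r k = vzero); last by have [_] := advance k IH h0.
  have [-> e1] := run_frozen run k h0.
  have [hV hS] := IH.1 k (leqnn k).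
  rewrite e1 h0 norm2_vzero; do 3!split=> //; first lra.
  by move=> _; apply: Rmult_le_pos; [lra | exact: norm2_ge0].
split; first by move=> k; have [h _] := good_all k; have [] := h k (leqnn k).
split.
  move=> k _ h0 _; have [hU _] := advance k (good_all k) h0.
  by have [] := hUV _ hU.
split=> [k h0|k hk]; last first.
  by apply: (run_restart run) => //; exact: (gmono k).
have [hmp hcs] := coefs k (good_all k) h0.
split; first exact: (run_depth_le run).
split=> //; split; last by have [_ [_ [_ []]]] := advance k (good_all k) h0.
move=> i hi; have hb : 0 < mu / (1 - mu) by apply: Rdiv_lt_0_compat; lra.
have := condition_pow_le (mu / (1 - mu)) (m k) hb.
have -> : 3 + 2 * (mu / (1 - mu)) = q by rewrite /q; field; lra.
(* A single coefficient is at most the absolute sum, hence at most [2 q^m - 1], and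
   [q^m <= 5^m (1 + b^m)] with [b = mu / (1 - mu)]. *)
suff : Rabs (c k i) <= sum_f_R0 (fun i => Rabs (c k i)) (m k) by lra.
elim: (m k) hi => [|mk IH]; first by rewrite leqn0 => /eqP ->; exact: Rle_refl.
rewrite leq_eqVlt => /orP [/eqP ->|/IH] /=.
  have := cond_pos_sum (fun i => Rabs (c k i)) mk (fun=> Rabs_pos _); lra.
have := Rabs_pos (c k mk.+1); lra.
Qed.
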